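(* Let $P$ be a set with a symmetric reflexive relation $\mathcal{C}$, and let $H(P,\mathcal{C})$ be the class of heaps with pieces in $P$ and concurrency relation $\mathcal{C}$. Fix a field $k$ (used to define acyclicity). The following are equivalent: (i) every heap in $H(P,\mathcal{C})$ with property P2 has property P1 (i.e. $H(P,\mathcal{C})$ is regular); (ii) every heap in $H(P,\mathcal{C})$ with property P2 is strongly acyclic; (ii$'$) for heaps in $H(P,\mathcal{C})$, property P2 is equivalent to being strongly acyclic; (iii) if $E$ is a heap with property P2 then, for any vertex $a$ of $E$, $E(a)$ is equal, as an element of $TL(P,\mathcal{C})$, to a heap with property P2; (iii$'$) whenever $p_1p_2\cdots p_r$ is a monomial basis element of $TL(P,\mathcal{C})$, the monomial obtained by deleting one of the $p_i$ is equal (as an element of $TL(P,\mathcal{C})$) to a monomial basis element.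
   Context: A labelled heap with pieces in $P$ is a triple $(E,\le,\varepsilon)$ with $(E,\le)$ a finite poset and $\varepsilon:E\to P$ such that: (1) if $\varepsilon(a)\,\mathcal{C}\,\varepsilon(b)$ then $a,b$ are comparable; (2) $\le$ is the transitive closure of the relation ''$a\le b$ and $\varepsilon(a)\,\mathcal{C}\,\varepsilon(b)$''. A heap is an isomorphism class of labelled heaps under label-preserving poset isomorphisms; $H(P,\mathcal{C})$ is the set of heaps. For $F\subseteq E$, the subheap on $F$ has order the transitive closure of ''$a\le b$ and $\varepsilon(a)\,\mathcal{C}\,\varepsilon(b)$'' on $F$; $E(v)$ denotes the subheap on $E\setminus\{v\}$. The product $E\circ F$ is the disjoint union with order the transitive closure of the orders of $E$, $F$ and the relations $a\le b$ for $a\in E$, $b\in F$ with $\varepsilon(a)\,\mathcal{C}\,\varepsilon(b)$; this makes $H(P,\mathcal{C})$ a monoid. A heap is trivial if its order is trivial. Let $\mathcal{L}(E)$, $\mathcal{R}(E)$ be the sets of minimal, maximal elements of $E$. Convex chain: a chain $x_1<\dots<x_t$ such that any $y$ with $x_i<y<x_j$ lies in the chain; its length is $t$; it is balanced if $\varepsilon(x_1)=\varepsilon(x_t)$. Property P2: $E$ has no balanced convex chains of length 2 or 3. Write $E(a)\prec^+E$ if $a\in\mathcal{R}(E)$ and there is $b\in\mathcal{R}(E(a))\setminus\mathcal{R}(E)$ with $\varepsilon(b)\ne\varepsilon(a)$; $E(a)\prec^-E$ likewise with $\mathcal{L}$ in place of $\mathcal{R}$; $\prec$ means $\prec^+$ or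 $\prec^-$. Property P1: there is a (possibly trivial) sequence $E_1\prec E_2\prec\cdots\prec E$ with $E_1$ a trivial heap. $H(P,\mathcal{C})$ is regular if every heap with P2 has P1. Acyclicity: let $C_0$ be the $k$-span of the elements of $E$ and $C_1$ the $k$-span of all pairs $(x,y)$ with $x<y$, $\varepsilon(x)=\varepsilon(y)$ and no $z$ with $\varepsilon(z)=\varepsilon(x)$ and $x<z<y$. Define $\partial_E:C_1\to C_0$ by $(x,y)\mapsto\sum_{x<w<y,\ \varepsilon(w)\,\mathcal{C}\,\varepsilon(x)}w$. $E$ is acyclic if $\ker\partial_E=0$, and strongly acyclic if $E$ and every $E(v)$ ($v\in E$) are acyclic. $TL(P,\mathcal{C})$: with $\mathcal{A}=\mathbb{Z}[v,v^{-1}]$ and $\delta=v+v^{-1}$, it is the quotient of the $\mathcal{A}$-algebra of the monoid generated by $P$ subject to $st=ts$ whenever $s,t$ are not related by $\mathcal{C}$, by the relations $ss=\delta s$ and $sts=s$ for $s\ne t$ with $s\,\mathcal{C}\,t$. The heap monoid is isomorphic to this commutation monoid via $a_1\circ\cdots\circ a_r\mapsto\varepsilon(a_1)\cdots\varepsilon(a_r)$, so heaps give elements of $TL(P,\mathcal{C})$. The images of heaps with property P2 form a free $\mathcal{A}$-basis of $TL(P,\mathcal{C})$, called the monomial basis. *)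

(* Defs.v *)
From HB Require Import structures.
From mathcomp Require Import all_boot all_order all_algebra.
From mathcomp Require Import generic_quotient ring_quotient fraction.
From mathcomp Require Import boolp finmap monalg.

Set Implicit Arguments.
Unset Strict Implicit.
Unset Printing Implicit Defensive.

Import GRing.Theory.

Local Open Scope ring_scope.
Local Open Scope quotient_scope.

(* The ring Z[v, v^-1], as a subring of the field of fractions of Z[v]. *)
Section Laurent.

Local Notation "x %:F" := (@FracField.tofrac _ x).

Definition frac_v : {fraction {poly int}} := 'X%:F.

Definition is_laurent : {pred {fraction {poly int}}} :=
  [pred x | `[< exists (p : {poly int}) (n : nat), x = p%:F / frac_v ^+ n >]].

Lemma frac_v_neq0 : frac_v != 0.
Proof. by rewrite tofrac_eq0 polyX_eq0. Qed.

Lemma is_laurent_subring : subring_closed is_laurent.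
Proof.
have nz n : frac_v ^+ n != 0 by rewrite expf_neq0 ?frac_v_neq0.
split.
- by apply/asboolP; exists 1, 0%N; rewrite tofrac1 expr0 divr1.
- move=> _ _ /asboolP[p [n ->]] /asboolP[q [m ->]]; apply/asboolP.
  exists (p * 'X^m - q * 'X^n), (n + m)%N.
  rewrite tofracB !tofracM !tofracXn exprD -/frac_v.
  by rewrite -[in LHS]mulNr addf_div ?nz ?mulNr.
- move=> _ _ /asboolP[p [n ->]] /asboolP[q [m ->]]; apply/asboolP.
  by exists (p * q), (n + m)%N; rewrite tofracM mulf_div exprD.
Qed.

HB.instance Definition _ :=
  GRing.isSubringClosed.Build {fraction {poly int}} is_laurent
    is_laurent_subring.

Record laurent := Laurent {
  laurent_val :> {fraction {poly int}};
  laurentP : laurent_val \in is_laurent }.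

HB.instance Definition _ := [isSub for laurent_val].
HB.instance Definition _ := [Choice of laurent by <:].
HB.instance Definition _ := [SubChoice_isSubComNzRing of laurent by <:].

Lemma laurent_vP : frac_v \in is_laurent.
Proof. by apply/asboolP; exists 'X, 0%N; rewrite expr0 divr1. Qed.

Lemma laurent_VvP : frac_v^-1 \in is_laurent.
Proof. by apply/asboolP; exists 1, 1%N; rewrite tofrac1 div1r. Qed.

Definition laurent_v : laurent := Laurent laurent_vP.
Definition laurent_Vv : laurent := Laurent laurent_VvP.
Definition delta : laurent := laurent_v + laurent_Vv.

End Laurent.

Record concurrency (P : choiceType) := Concurrency {
  conc :> rel P;
  conc_refl : reflexive conc;
  conc_sym : symmetric conc }.

Section CommutationMonoid.

Variables (P : choiceType) (C : concurrency P).

Inductive commutes : seq P -> seq P -> Prop :=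
| commutes_swap u v s t : ~~ C s t ->
    commutes (u ++ [:: s; t] ++ v) (u ++ [:: t; s] ++ v)
| commutes_refl u : commutes u u
| commutes_sym u v : commutes u v -> commutes v u
| commutes_trans u v w : commutes u v -> commutes v w -> commutes u w.

Definition commutesb (u v : seq P) : bool := `[< commutes u v >].

Lemma commutesb_equiv : equiv_class_of commutesb.
Proof.
split=> [u|u v|v u w]; first by apply/asboolP/commutes_refl.
  by apply/asboolP/asboolP; apply: commutes_sym.
move=> /asboolP uv /asboolP vw; apply/asboolP; exact: commutes_trans uv vw.
Qed.

Canonical commutesb_equiv_rel := EquivRelPack commutesb_equiv.
Canonical commutesb_encModRel := defaultEncModRel commutesb.

Definition cmonoid := {eq_quot commutesb}.

HB.instance Definition _ : EqQuotient (seq P) commutesb cmonoid :=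
  EqQuotient.on cmonoid.
HB.instance Definition _ := Choice.on cmonoid.

Lemma cmonoid_eqP (u v : seq P) :
  reflect (commutes u v) (u == v %[mod cmonoid]).
Proof. by rewrite piE; apply: asboolP. Qed.

Lemma commutes_size u v : commutes u v -> size u = size v.
Proof.
elim=> [u' v' s t _|//|u' v' _ -> //|u' v' w' _ -> _ -> //].
by rewrite !size_cat.
Qed.

Lemma commutes_catl w u v : commutes u v -> commutes (w ++ u) (w ++ v).
Proof.
elim=> [u' v' s t Cst|u'|u' v' _|u' v' w' _ uv _ vw].
- by rewrite !(catA w); apply: commutes_swap.
- exact: commutes_refl.
- exact: commutes_sym.
- exact: commutes_trans uv vw.
Qed.

Lemma commutes_catr w u v : commutes u v -> commutes (u ++ w) (v ++ w).
Proof.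
elim=> [u' v' s t Cst|u'|u' v' _|u' v' w' _ uv _ vw].
- by rewrite -!catA; apply: commutes_swap.
- exact: commutes_refl.
- exact: commutes_sym.
- exact: commutes_trans uv vw.
Qed.

Definition cm_one : cmonoid := \pi_cmonoid [::].
Definition cm_mul := lift_op2 cmonoid (@cat P).

Lemma cm_mul_pi u v :
  cm_mul (\pi_cmonoid u) (\pi_cmonoid v) = \pi_cmonoid (u ++ v).
Proof.
have repr_pi w : commutes (repr (\pi_cmonoid w)) w.
  by apply/cmonoid_eqP; rewrite reprK.
unlock cm_mul; apply/eqP/cmonoid_eqP.
apply: (@commutes_trans _ (u ++ repr (\pi_cmonoid v))).
  exact: commutes_catr.
exact: commutes_catl.
Qed.

Lemma cm_mulA : associative cm_mul.
Proof.
by move=> x y z; rewrite -[x]reprK -[y]reprK -[z]reprK !cm_mul_pi catA.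
Qed.

Lemma cm_mul1 : left_id cm_one cm_mul.
Proof. by move=> x; rewrite -[x]reprK cm_mul_pi. Qed.

Lemma cm_mulr1 : right_id cm_one cm_mul.
Proof. by move=> x; rewrite -[x]reprK cm_mul_pi cats0. Qed.

Lemma cm_unit x y : cm_mul x y = cm_one -> x = cm_one /\ y = cm_one.
Proof.
rewrite -[x]reprK -[y]reprK cm_mul_pi => /eqP/cmonoid_eqP/commutes_size.
by case: (repr x) => [|? ?] //; case: (repr y).
Qed.

HB.instance Definition _ := Choice_isMonomialDef.Build cmonoid
  cm_mulA cm_mul1 cm_mulr1 cm_unit.

Definition calgebra := {malg laurent[cmonoid]}.

Definition cword (w : seq P) : calgebra := << \pi_cmonoid w >>.

Variant tl_relator : calgebra -> Prop :=
| tl_relator_square s :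
    tl_relator (cword [:: s; s] - delta *: cword [:: s])
| tl_relator_braid s t : s != t -> C s t ->
    tl_relator (cword [:: s; t; s] - cword [:: s]).

Inductive tl_ideal_gen : calgebra -> Prop :=
| tl_ideal_relator x : tl_relator x -> tl_ideal_gen x
| tl_ideal0 : tl_ideal_gen 0
| tl_idealD x y : tl_ideal_gen x -> tl_ideal_gen y -> tl_ideal_gen (x + y)
| tl_idealMl a x : tl_ideal_gen x -> tl_ideal_gen (a * x)
| tl_idealMr a x : tl_ideal_gen x -> tl_ideal_gen (x * a).

Definition tl_ideal : {pred calgebra} := [pred x | `[< tl_ideal_gen x >]].

Lemma tl_ideal_zmod : zmod_closed tl_ideal.
Proof.
split; first exact/asboolP/tl_ideal0.
move=> x y /asboolP xI /asboolP yI; apply/asboolP.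
by rewrite -mulN1r; apply: tl_idealD => //; apply: tl_idealMl.
Qed.

HB.instance Definition _ :=
  GRing.isZmodClosed.Build calgebra tl_ideal tl_ideal_zmod.

Definition TL : Type := Quotient.quot tl_ideal.

HB.instance Definition _ := GRing.Zmodule.on TL.
HB.instance Definition _ :
  ZmodQuotient calgebra (Quotient.equiv tl_ideal) 0 -%R +%R TL :=
  ZmodQuotient.on TL.

Lemma tl_eqP (x y : calgebra) :
  reflect (tl_ideal_gen (x - y)) (x == y %[mod TL]).
Proof. by rewrite -Quotient.idealrBE; apply: asboolP. Qed.

Definition tl_one : TL := \pi_TL 1.
Definition tl_mul := lift_op2 TL *%R.
Definition tl_scale (a : laurent) := lift_op1 TL ( *:%R a).

Lemma tl_repr_pi (x : calgebra) : tl_ideal_gen (repr (\pi_TL x) - x).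
Proof. by apply/tl_eqP; rewrite reprK. Qed.

Lemma tl_mul_pi x y : tl_mul (\pi_TL x) (\pi_TL y) = \pi_TL (x * y).
Proof.
unlock tl_mul; apply/eqP/tl_eqP.
rewrite -[_ * _](addrNK (x * repr (\pi_TL y))) -mulrBl -addrA -mulrBr.
apply: tl_idealD; first exact/tl_idealMr/tl_repr_pi.
exact/tl_idealMl/tl_repr_pi.
Qed.

Lemma tl_scale_pi a x : tl_scale a (\pi_TL x) = \pi_TL (a *: x).
Proof.
rewrite /tl_scale; unlock; apply/eqP/tl_eqP.
rewrite -scalerBr -[_ - x]mul1r scalerAl.
exact/tl_idealMl/tl_repr_pi.
Qed.

Lemma tl_mulA : associative tl_mul.
Proof.
by move=> x y z; rewrite -[x]reprK -[y]reprK -[z]reprK !tl_mul_pi mulrA.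
Qed.

Lemma tl_mul1 : left_id tl_one tl_mul.
Proof. by move=> x; rewrite -[x]reprK tl_mul_pi mul1r. Qed.

Lemma tl_mulr1 : right_id tl_one tl_mul.
Proof. by move=> x; rewrite -[x]reprK tl_mul_pi mulr1. Qed.

Lemma tl_piD (x y : calgebra) : \pi_TL (x + y) = \pi_TL x + \pi_TL y.
Proof. exact: pi_addr. Qed.

Lemma tl_mulDl : left_distributive tl_mul +%R.
Proof.
move=> x y z; rewrite -[x]reprK -[y]reprK -[z]reprK.
by rewrite -tl_piD !tl_mul_pi -tl_piD mulrDl.
Qed.

Lemma tl_mulDr : right_distributive tl_mul +%R.
Proof.
move=> x y z; rewrite -[x]reprK -[y]reprK -[z]reprK.
by rewrite -tl_piD !tl_mul_pi -tl_piD mulrDr.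
Qed.

HB.instance Definition _ := GRing.Zmodule_isPzRing.Build TL
  tl_mulA tl_mul1 tl_mulr1 tl_mulDl tl_mulDr.

Lemma tl_scaleA a b x : tl_scale a (tl_scale b x) = tl_scale (a * b) x.
Proof. by rewrite -[x]reprK !tl_scale_pi scalerA. Qed.

Lemma tl_scale1 : left_id 1 tl_scale.
Proof. by move=> x; rewrite -[x]reprK tl_scale_pi scale1r. Qed.

Lemma tl_scaleDr : right_distributive tl_scale +%R.
Proof.
move=> a x y; rewrite -[x]reprK -[y]reprK.
by rewrite -tl_piD !tl_scale_pi -tl_piD scalerDr.
Qed.

Lemma tl_scaleDl x : {morph tl_scale^~ x : a b / a + b}.
Proof.
by move=> a b; rewrite -[x]reprK !tl_scale_pi -tl_piD scalerDl.
Qed.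

HB.instance Definition _ := GRing.Zmodule_isLmodule.Build laurent TL
  tl_scaleA tl_scale1 tl_scaleDr tl_scaleDl.

Definition tl_word (w : seq P) : TL := \pi_TL (cword w).

Lemma tl_word_cat u v : tl_word (u ++ v) = tl_word u * tl_word v.
Proof.
rewrite [RHS]tl_mul_pi; congr (\pi_TL _).
by rewrite /cword [RHS]malgM_def fgmulUU mulr1 /mmul /= cm_mul_pi.
Qed.

Lemma tl_word_comm s t : ~~ C s t -> tl_word [:: s; t] = tl_word [:: t; s].
Proof.
move=> Cst; congr (\pi_TL << _ >>); apply/eqP/cmonoid_eqP.
exact: (commutes_swap [::] [::]).
Qed.

Lemma tl_word_square s : tl_word [:: s; s] = delta *: tl_word [:: s].
Proof.
rewrite [RHS]tl_scale_pi; apply/eqP/tl_eqP.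
exact/tl_ideal_relator/tl_relator_square.
Qed.

Lemma tl_word_braid s t : s != t -> C s t ->
  tl_word [:: s; t; s] = tl_word [:: s].
Proof.
by move=> st Cst; apply/eqP/tl_eqP/tl_ideal_relator/tl_relator_braid.
Qed.

End CommutationMonoid.

Section Heaps.

Variables (P : choiceType) (C : concurrency P).

(* [connect r] is the reflexive transitive closure of r; every relation closed
   below is reflexive because C is, so this is its transitive closure. *)
Record heap := Heap {
  carrier :> finType;
  hle : rel carrier;
  label : carrier -> P;
  hle_refl : reflexive hle;
  hle_anti : antisymmetric hle;
  hle_trans : transitive hle;
  hle_conc : forall a b, C (label a) (label b) -> hle a b || hle b a;
  hle_gen : hle =2 connect [rel a b | hle a b && C (label a) (label b)] }.

Definition hlt (E : heap) : rel E := [rel a b | (a != b) && hle a b].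

Definition heap_iso (E F : heap) : Prop :=
  exists f : E -> F,
    [/\ bijective f, {mono f : a b / hle a b}
      & forall a, label (f a) = label a].

Section Subheap.

Variables (E : heap) (F : {set E}).

Let T : finType := {x : E | x \in F}.
Let lab (a : T) : P := label (val a).
Let cov : rel T := [rel a b | hle (val a) (val b) && C (lab a) (lab b)].

Lemma subheap_sub a b : connect cov a b -> hle (val a) (val b).
Proof.
case/connectP=> p + ->; elim: p a => [|c p IHp] a /=.
  by rewrite hle_refl.
by case/andP=> /andP[ac _] /IHp; apply: hle_trans.
Qed.

Lemma subheap_anti : antisymmetric (connect cov).
Proof.
move=> a b /andP[/subheap_sub ab /subheap_sub ba].
by apply/val_inj/hle_anti; rewrite ab ba.
Qed.

Lemma subheap_conc a b :
  C (lab a) (lab b) -> connect cov a b || connect cov b a.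
Proof.
move=> Cab; have /orP[ab|ba] := hle_conc Cab; apply/orP; [left|right].
  by apply/connect1/andP.
by apply/connect1/andP; rewrite conc_sym.
Qed.

Lemma subheap_gen :
  connect cov =2 connect [rel a b | connect cov a b && C (lab a) (lab b)].
Proof.
move=> a b; apply/idP/idP; apply: connect_sub => {a b}a b /=.
  by move=> ab; apply: connect1 => /=; rewrite (connect1 ab); case/andP: ab.
by case/andP.
Qed.

Definition subheap : heap :=
  @Heap T (connect cov) lab (@connect0 _ cov) subheap_anti
    (@connect_trans _ cov) subheap_conc subheap_gen.

End Subheap.

Definition hdel (E : heap) (v : E) : heap := subheap [set~ v].

Section Product.

Variables E F : heap.

Definition hprod_label (u : E + F) : P :=
  match u with inl a => label a | inr b => label b end.

Definition hprod_rel : rel (E + F) := fun u v =>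
  match u, v with
  | inl a, inl b => hle a b
  | inr a, inr b => hle a b
  | inl a, inr b => C (label a) (label b)
  | inr _, inl _ => false
  end.

Lemma hprod_connectl u a : connect hprod_rel u (inl a) ->
  exists2 b, u = inl b & hle b a.
Proof.
case/connectP=> p; elim: p u => [|v p IHp] u /=.
  by move=> _ <-; exists a => //; apply: hle_refl.
case/andP=> uv /IHp pa /pa[b vE ba]; rewrite {}vE in uv.
by case: u uv => //= c cb; exists c => //; apply: hle_trans ba.
Qed.

Lemma hprod_connectr a v : connect hprod_rel (inr a) v ->
  exists2 b, v = inr b & hle a b.
Proof.
case/connectP=> p; elim: p a => [|w p IHp] a /=.
  by move=> _ ->; exists a => //; apply: hle_refl.
case: w => [//|c] /andP[/= ac /IHp pv] /pv[b -> cb].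
by exists b => //; apply: hle_trans cb.
Qed.

Lemma hprod_anti : antisymmetric (connect hprod_rel).
Proof.
case=> [a|a] v /andP[].
  move=> av /hprod_connectl[b vE ba]; rewrite {}vE in av *.
  have [c [cE] cb] := hprod_connectl av; rewrite -{}cE in cb.
  by congr inl; apply: hle_anti; rewrite cb ba.
case/hprod_connectr=> b -> ab /hprod_connectr[c [cE] bc].
by congr inr; apply: hle_anti; rewrite ab cE bc.
Qed.

Lemma hprod_conc u v : C (hprod_label u) (hprod_label v) ->
  connect hprod_rel u v || connect hprod_rel v u.
Proof.
case: u v => [a|a] [b|b] /= Cab.
- by case/orP: (hle_conc Cab) => ab; apply/orP; [left|right]; apply: connect1.
- by rewrite connect1.
- by rewrite orbC connect1 //= conc_sym.
- by case/orP: (hle_conc Cab) => ab; apply/orP; [left|right]; apply: connect1.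
Qed.

Lemma hprod_gen : connect hprod_rel =2
  connect [rel u v | connect hprod_rel u v
                     && C (hprod_label u) (hprod_label v)].
Proof.
move=> u v; apply/idP/idP; last first.
  by apply: connect_sub => {u v}u v /andP[].
apply: connect_sub => {u v}; case=> [a|a] [b|b] //= ab.
- move: ab; rewrite hle_gen => /connectP[p + ->].
  elim: p a => [|c p IHp] a /= => [|/andP[/andP[ac Cac] /IHp]].
    by rewrite connect0.
  by apply/connect_trans/connect1; rewrite /= Cac andbT; apply: connect1.
- by apply: connect1; rewrite /= connect1.
- move: ab; rewrite hle_gen => /connectP[p + ->].
  elim: p a => [|c p IHp] a /= => [|/andP[/andP[ac Cac] /IHp]].
    by rewrite connect0.
  by apply/connect_trans/connect1; rewrite /= Cac andbT; apply: connect1.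
Qed.

Definition hprod : heap :=
  @Heap (E + F)%type (connect hprod_rel) hprod_label (@connect0 _ hprod_rel)
    hprod_anti (@connect_trans _ hprod_rel) hprod_conc hprod_gen.

End Product.

Section Pieces.

Let leT (T : finType) : rel T := fun _ _ => true.

Lemma void_gen (lab : void -> P) :
  @leT void =2 connect [rel a b | leT a b && C (lab a) (lab b)].
Proof. by case. Qed.

Definition hempty : heap.
Proof.
by refine (@Heap void (@leT void) (of_void P) _ _ _ _ (@void_gen _)); case.
Defined.

Lemma unit_gen (lab : unit -> P) :
  @leT unit =2 connect [rel a b | leT a b && C (lab a) (lab b)].
Proof. by case; case; rewrite connect0. Qed.

Definition hpiece (p : P) : heap.
Proof.
by refine (@Heap unit (@leT unit) (fun=> p) _ _ _ _ (@unit_gen _)) => //;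
  case=> [] [].
Defined.

End Pieces.

Definition word_heap (w : seq P) : heap :=
  foldr (fun p E => hprod (hpiece p) E) hempty w.

(* Sorting by the size of principal ideals gives a linear extension of E. *)
Definition hlinear (E : heap) : seq E :=
  sort (fun a b => #|[set x | hle x a]| <= #|[set x | hle x b]|)%N (enum E).

Definition heap_word (E : heap) : seq P := [seq label a | a <- hlinear E].

Lemma heap_iso_refl E : heap_iso E E.
Proof. by exists id; split=> //; exists id. Qed.

Lemma heap_iso_sym E F : heap_iso E F -> heap_iso F E.
Proof.
case=> f [[g fK gK] f_le f_lab]; exists g; split; first by exists f.
  by move=> a b; rewrite -f_le !gK.
by move=> a; rewrite -f_lab gK.
Qed.

Lemma heap_iso_trans E F G : heap_iso E F -> heap_iso F G -> heap_iso E G.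
Proof.
case=> f [f_bij f_le f_lab] [g [g_bij g_le g_lab]]; exists (g \o f); split.
- exact: bij_comp.
- by move=> a b /=; rewrite g_le f_le.
- by move=> a /=; rewrite g_lab f_lab.
Qed.

Lemma heap_iso_hprodr E F G : heap_iso F G -> heap_iso (hprod E F) (hprod E G).
Proof.
case=> f [[g fK gK] f_le f_lab].
pose h (u : E + F) : E + G :=
  match u with inl a => inl a | inr b => inr (f b) end.
pose k (u : E + G) : E + F :=
  match u with inl a => inl a | inr b => inr (g b) end.
have hK : cancel h k by case=> [a|b] //=; rewrite fK.
have kK : cancel k h by case=> [a|b] //=; rewrite gK.
have h_rel u v : hprod_rel (h u) (h v) = hprod_rel u v.
  by case: u v => [a|a] [b|b] //=; rewrite ?f_le ?f_lab.
exists h; split; first by exists k.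
  move=> u v; rewrite /hle /=; apply/idP/idP => [|/connectP[p + ->]].
    rewrite -{2}[u]hK -{2}[v]hK => /connectP[p + ->].
    elim: p (h u) => [|w p IHp] x /=; first by rewrite connect0.
    case/andP=> xw /IHp; apply/connect_trans/connect1.
    by rewrite -h_rel !kK.
  elim: p u => [|w p IHp] x /=; first by rewrite connect0.
  by case/andP=> xw /IHp; apply/connect_trans/connect1; rewrite h_rel.
by case=> [a|b] //=; rewrite f_lab.
Qed.

Lemma hprod_min (E : heap) (a : E) : (forall x, hle x a -> x = a) ->
  heap_iso E (hprod (hpiece (label a)) (hdel a)).
Proof.
move=> a_min; apply: heap_iso_sym.
pose F := hprod (hpiece (label a)) (hdel a).
pose g (u : F) : E := match u with inl _ => a | inr y => val y end.
pose f (x : E) : F := if insub x is Some y then inr y else inl tt.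
have fP x : (x = a /\ f x = inl tt) \/ exists2 y, val y = x & f x = inr y.
  rewrite /f; case: insubP => [y _ <-|xF]; first by right; exists y.
  left; split=> //.
  by apply/eqP; rewrite in_setC1 negbK in xF.
have nva (y : hdel a) : val y <> a.
  by have := valP y; rewrite in_setC1 => /eqP.
have gK : cancel g f.
  case=> [[]|y] /=; last by rewrite /f valK.
  by case: (fP a) => [[]//|[y ya]]; case: (nva y).
have fK : cancel f g.
  by move=> x; case: (fP x) => [[-> ->]//|[y <- ->]].
exists g; split; [by exists f | | by case=> [[]|y]].
move=> u v; apply/idP/idP; last first.
  rewrite [hle u v]/=; case/connectP=> p + ->.
  elim: p u => [|w p IHp] u /=; first by rewrite hle_refl.
  case/andP=> uw /IHp; apply: hle_trans.
  case: u w uw {IHp} => [[]|y] [[]|z] //=.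
  - by rewrite hle_refl.
  - move=> Caz; have /orP[//|za] := hle_conc Caz.
    by case: (nva z); apply: a_min.
  - exact: subheap_sub.
rewrite hle_gen -{2}[u]gK -{2}[v]gK => /connectP[p + ->].
elim: p (g u) => [|y p IHp] x /=; first by rewrite connect0.
case/andP=> /andP[xy Cxy] /IHp; apply/connect_trans/connect1.
case: (fP x) (fP y) xy Cxy => [[-> ->]|[x' <- ->]] [[-> ->]|[y' <- ->]] //=
  xy Cxy.
  by case: (nva x'); apply: a_min.
by apply/connect1/andP.
Qed.

Lemma word_heap_linear (E : heap) (s : seq E) :
    uniq s -> s =i E ->
    (forall a b, hle a b -> (index a s <= index b s)%N) ->
  heap_iso E (word_heap [seq label a | a <- s]).
Proof.
move: {2}(size s) (erefl (size s)) => n; elim: n E s => [|n IHn] E [|a s] //=.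
  move=> _ _ sE _; have E0 (a : E) : False by have := sE a.
  exists (fun a => match E0 a with end); split=> [|a|a]; try by case: (E0 a).
  by exists (of_void E) => [a|[]]; case: (E0 a).
case=> size_s /andP[a's s_uniq] sE s_le.
apply: (@heap_iso_trans _ (hprod (hpiece (label a)) (hdel a))).
  apply: hprod_min => x /s_le; rewrite eqxx leqn0.
  by case: (a =P x) => // ->.
apply: heap_iso_hprodr.
pose t : seq (hdel a) := pmap insub s.
have tE : [seq val x | x <- t] = s.
  rewrite /t pmap_filter; last exact: insubK.
  apply/all_filterP/allP => x xs.
  by rewrite isSome_insub in_setC1; apply: contraNneq a's => <-.
have -> : [seq label b | b <- s] = [seq label b | b <- t].
  by rewrite -tE -map_comp.
have t_ind x : index (val x) s = index x t.
  by rewrite -tE index_map //; apply: val_inj.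
apply: IHn.
- by rewrite -(size_map val) tE.
- by rewrite -(map_inj_uniq val_inj) tE.
- move=> x; rewrite -(mem_map val_inj) tE.
  have := sE (val x); rewrite !inE.
  by have := valP x; rewrite in_setC1 => /negPf->.
- move=> x y /subheap_sub/s_le; rewrite !t_ind.
  have := valP x; have := valP y; rewrite !in_setC1 ![_ == a]eq_sym.
  by move=> /negPf-> /negPf->.
Qed.

(* The class of heap_word E in the commutation monoid is thus the image of E
   under the isomorphism sending p_1 o ... o p_r to p_1 ... p_r. *)
Lemma heap_wordK (E : heap) : heap_iso E (word_heap (heap_word E)).
Proof.
apply: word_heap_linear.
- by rewrite sort_uniq enum_uniq.
- by move=> a; rewrite mem_sort mem_enum.
move=> a b ab.
have [->//|neq_ab] := eqVneq a b.
have lt_ab : (#|[set x | hle x a]| < #|[set x | hle x b]|)%N.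
  apply/proper_card/properP; split.
    by apply/subsetP=> x; rewrite !inE => /hle_trans; apply.
  exists b; rewrite !inE ?hle_refl //.
  by apply: contra neq_ab => ba; apply/eqP/hle_anti; rewrite ab ba.
rewrite leqNgt; apply/negP => ba.
set r := fun a b : E => (#|[set x | hle x a]| <= #|[set x | hle x b]|)%N.
have r_trans : transitive r by move=> y x z; apply: leq_trans.
have r_sorted : sorted r (hlinear E).
  by apply: sort_sorted => x y; apply: leq_total.
have mem_l x : x \in hlinear E by rewrite mem_sort mem_enum.
have := sorted_ltn_index r_trans r_sorted _ _ (mem_l b) (mem_l a) ba.
by rewrite /r leqNgt lt_ab.
Qed.

Definition htrivial (E : heap) : Prop := forall a b : E, hle a b -> a = b.

Definition hmin (E : heap) : {set E} :=
  [set a | [forall b, hle b a ==> (b == a)]].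
Definition hmax (E : heap) : {set E} :=
  [set a | [forall b, hle a b ==> (b == a)]].

Definition convex_chain (E : heap) (s : seq E) : Prop :=
  sorted (@hlt E) s /\
  forall x y z, x \in s -> z \in s -> hlt x y -> hlt y z -> y \in s.

Definition balanced (E : heap) (s : seq E) : Prop :=
  if s is x :: s' then label x = label (last x s') else False.

Definition propP2 (E : heap) : Prop :=
  forall s : seq E, convex_chain s -> balanced s ->
    size s <> 2%N /\ size s <> 3%N.

Definition hprec_plus (E : heap) (a : E) : Prop :=
  a \in hmax E /\
  exists b : hdel a,
    [/\ b \in hmax (hdel a), val b \notin hmax E & label b <> label a].

Definition hprec_minus (E : heap) (a : E) : Prop :=
  a \in hmin E /\
  exists b : hdel a,
    [/\ b \in hmin (hdel a), val b \notin hmin E & label b <> label a].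

(* [heap] is the type of labelled heaps; a heap proper is an isomorphism class,
   whence the isomorphism here. *)
Definition hprec (F E : heap) : Prop :=
  exists a : E, heap_iso F (hdel a) /\ (hprec_plus a \/ hprec_minus a).

Inductive propP1 : heap -> Prop :=
| propP1_trivial E : htrivial E -> propP1 E
| propP1_prec F E : propP1 F -> hprec F E -> propP1 E.

Definition regular : Prop := forall E : heap, propP2 E -> propP1 E.

Section Acyclic.

Variables (k : fieldType) (E : heap).

Definition is_edge (e : E * E) : bool :=
  [&& hlt e.1 e.2, label e.1 == label e.2 &
      ~~ [exists z, [&& label z == label e.1, hlt e.1 z & hlt z e.2]]].

Definition edge : finType := {e : E * E | is_edge e}.

Definition chain0 := {ffun E -> k^o}.
Definition chain1 := {ffun edge -> k^o}.

Definition vertex_chain (w : E) : chain0 := [ffun x => (x == w)%:R].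

Definition edge_boundary (e : edge) : chain0 :=
  let: (x, y) := val e in
  \sum_(w | [&& hlt x w, hlt w y & C (label w) (label x)]) vertex_chain w.

Definition boundary (f : chain1) : chain0 := \sum_e f e *: edge_boundary e.

Definition acyclic : Prop := forall f : chain1, boundary f = 0 -> f = 0.

End Acyclic.

Definition strongly_acyclic (k : fieldType) (E : heap) : Prop :=
  acyclic k E /\ forall v : E, acyclic k (hdel v).

Definition tl_heap (E : heap) : TL C := tl_word C (heap_word E).

Definition monomial_basis (x : TL C) : Prop :=
  exists2 E : heap, propP2 E & x = tl_heap E.

End Heaps.

(* Main.v *)
Require Import Defs.
From mathcomp Require Import all_boot all_order all_algebra.
From mathcomp Require Import generic_quotient fraction boolp finmap monalg zify.

(** Fix a heap together with a linear extension and call a set of vertices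
    alive if no sequence of braid moves [sts -> s] ever produces a square [ss].
    Braid moves are locally confluent up to the appearance of squares, so
    aliveness is invariant under braid moves; hence "sum of the coefficients of
    the alive monomials, modulo delta" is well defined on [TL], and a monomial
    equals a basis element exactly when it is alive.

    A 1-chain is recorded by its jumps at the vertices.  In these terms a
    square is a cycle, a braid move preserves acyclicity, and so acyclic heaps
    are alive.  If [a] is maximal and deleting it exposes [b], acyclicity of
    [E] and of [E(v)] follows from that of [E(a)] and [E(a)(v)] except for
    [v = b]; there, either [E(b)] still has P2, or it admits a braid move
    [a' t a], after which one is left with [E] minus [a], [b], [t].

    Conversely, assume deletions from P2 heaps are alive, and let [E] be a
    nontrivial P2 heap with no predecessor for the relation "prec".  Write
    [E = U o M] with [M] the maximal elements; then [U o M o U^op] has P2.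
    Deleting a non-minimal element of the middle layer and applying symmetric
    braid moves gives a P2 heap of the same shape with one element less in the
    middle, without ever losing a minimal element of [E].  When only minimal
    elements are left in the middle, [U] is empty; so [E] has fewer minimal
    than maximal elements.  The opposite heap gives the reverse inequality. *)

Set Implicit Arguments.
Unset Strict Implicit.
Unset Printing Implicit Defensive.

Ltac rklia := repeat match goal with H : ?Q |- _ =>
  match type of Q with Prop =>
    lazymatch Q with is_true (leq _ _) => fail | _ => clear H end end end; lia.

(** * Ranked heaps, squares, braid moves and aliveness *)

Section RankedHeaps.

Variables (P : choiceType) (C : concurrency P).

(** A heap given by ranks instead of an order: concurrent elements are compared by rank, and these
    comparisons generate the order. Ranks need only separate concurrent elements, so sizes of
    ideals, reversed ranks and positions in a word all qualify. Subheaps become plain subsets, with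
    no transitive closure to recompute. *)
Record rheap := RHeap {
  rcar :> finType;
  rlab : rcar -> P;
  rk : rcar -> nat;
  rk_inj : forall a b, C (rlab a) (rlab b) -> rk a = rk b -> a = b }.

Definition rconc (T : rheap) (a b : T) := C (rlab a) (rlab b).

Section OneHeap.

Variable T : rheap.
Implicit Types (A B : {set T}) (a b x y z t : T).

Lemma rconcC a b : rconc a b = rconc b a.
Proof. exact: conc_sym. Qed.

Lemma rconc_lab a b z : rlab a = rlab b -> rconc z a = rconc z b.
Proof. by rewrite /rconc => ->. Qed.

Lemma rconc_labl a b z : rlab a = rlab b -> rconc a z = rconc b z.
Proof. by rewrite /rconc => ->. Qed.

Lemma rconc_eqlab a b : rlab a = rlab b -> rconc a b.
Proof. by rewrite /rconc => ->; exact: conc_refl. Qed.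

Lemma rk_neq a b : rconc a b -> a <> b -> rk a < rk b \/ rk b < rk a.
Proof.
move=> ab nab; case: (ltngtP (rk a) (rk b)) => [|| /(rk_inj ab)//]; by [left|right].
Qed.

(* [sq] and [br] are factors [ss] and [sts] up to commutation, that is, balanced
   convex chains of length 2 and 3; a [br] chain is shortened to its first
   element. *)
Definition sq A x y := [/\ x \in A, y \in A, rlab x = rlab y, rk x < rk y
  & forall z, z \in A -> rk x < rk z -> rk z < rk y -> ~~ rconc z x].

Definition br A x t y := [/\ [/\ x \in A, t \in A & y \in A],
  rk x < rk t /\ rk t < rk y, rlab x = rlab y, rlab t <> rlab x /\ rconc t x
  & forall z, z \in A -> rk x < rk z -> rk z < rk y -> rconc z x -> z = t].

(** The counterpart of P2 for ranked heaps; see [propP2_reduced]. *)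
Definition reduced A :=
  (forall x y, ~ sq A x y) /\ (forall x t y, ~ br A x t y).

Inductive reduces A : {set T} -> Prop :=
| reduces_refl : reduces A A
| reduces_step x t y B : br A x t y -> reduces (A :\ t :\ y) B -> reduces A B.

Definition alive A := forall B x y, reduces A B -> ~ sq B x y.

Lemma alive_sq A x y : alive A -> ~ sq A x y.
Proof. by move=> /(_ A x y); apply; constructor. Qed.

Lemma alive_br A x t y : alive A -> br A x t y -> alive (A :\ t :\ y).
Proof. by move=> aA b B p q r; apply: aA (reduces_step b r). Qed.

Lemma alive_intro A : (forall x y, ~ sq A x y) ->
  (forall x t y, br A x t y -> alive (A :\ t :\ y)) -> alive A.
Proof.
move=> sqA brA B p q r; case: r => [|x t y B' b r]; first exact: sqA.
exact: (brA _ _ _ b _ _ _ r).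
Qed.

Lemma reduced_alive A : reduced A -> alive A.
Proof. by case=> sqA brA; apply: alive_intro => // x t y /brA. Qed.

Lemma mem_D2 A t y z : (z \in A :\ t :\ y) = [&& z != y, z != t & z \in A].
Proof. by rewrite !inE. Qed.

(** Neither element of the square is [t], because [x] or [y] separates [t] from any other element
    with its label. The upper element is not [y], because [x] or [t] would intervene. If the lower
    element is [y], then [x] replaces it; otherwise the square survives as it is. *)
Lemma sq_braid A x t y p q : sq A p q -> br A x t y ->
  exists p' q', sq (A :\ t :\ y) p' q'.
Proof.
case=> pA qA lpq rpq spq [] [xA tA yA] [xt ty] lxy [ltx ctx] bxy.
have nty : t <> y by move=> e; move: ty; rewrite e ltnn.
have [ept|npt] := eqVneq p t.
  subst p; have cq : rconc q x by rewrite -(rconc_labl _ lpq).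
  have : rconc q y by rewrite -(rconc_lab _ lxy).
  case/rk_neq=> [eqy|qy|yq].
  - by case: ltx; rewrite lpq eqy.
  - have eqt := bxy q qA ltac:(rklia) qy cq; rewrite eqt in rpq; rklia.
  - by have := spq y yA ty yq; rewrite rconcC -(rconc_lab _ lxy) ctx.
have [eqt|nqt] := eqVneq q t.
  subst q; have cp : rconc p x by rewrite (rconc_labl _ lpq).
  case: (rk_neq cp) => [epx|px|xp].
  - by case: ltx; rewrite -lpq epx.
  - by have := spq x xA px xt; rewrite rconcC cp.
  - by have ept := bxy p pA xp ltac:(rklia) cp; rewrite ept eqxx in npt.
have [eqy|nqy] := eqVneq q y.
  subst q; have lpx : rlab p = rlab x by rewrite lpq lxy.
  have [epx|/eqP npx] := eqVneq p x.
    by subst p; have := spq t tA xt ty; rewrite ctx.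
  case: (rk_neq (rconc_eqlab lpx) npx) => [px|xp].
  - by have := spq x xA px ltac:(rklia); rewrite rconcC rconc_eqlab.
  - have ept := bxy p pA xp rpq (rconc_eqlab lpx).
    by rewrite ept eqxx in npt.
have [epy|npy] := eqVneq p y; last first.
  exists p, q; split=> //; rewrite ?mem_D2 ?npy ?npt ?nqy ?nqt //.
  by move=> z; rewrite mem_D2 => /and3P[_ _]; apply: spq.
subst p; exists x, q; split; rewrite ?mem_D2 ?nqy ?nqt //.
- by rewrite xA !andbT; apply/andP; split; apply/eqP => e; rewrite -?e in xt ty;
  rklia.
- by rewrite lxy.
- rklia.
- move=> z; rewrite mem_D2 => /and3P[/eqP nzy /eqP nzt zA] xz zq.
  apply/negP => czx; have czy : rconc z y by rewrite -(rconc_lab _ lxy).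
  case: (rk_neq czy nzy) => [zy|yz]; first by case: nzt; apply: bxy.
  by have := spq z zA yz zq; rewrite czy.
Qed.

(** The excluded coincidences leave only [x' = y] as a possible contact with the deleted elements;
    then the second move starts at [x] instead. *)
Lemma br_commute A x t y x' t' y' : br A x t y -> br A x' t' y' ->
    t' <> t -> t' <> y -> y' <> t -> y' <> y -> x' <> t ->
  exists x1, br (A :\ t :\ y) x1 t' y'.
Proof.
case=> [] [xA tA yA] [xt ty] lxy [ltx ctx] bxy.
case=> [] [xA' tA' yA'] [xt' ty'] lxy' [ltx' ctx'] bxy'.
move=> /eqP n1 /eqP n2 /eqP n3 /eqP n4 /eqP n5.
have [exy|n6] := eqVneq x' y; last first.
  exists x'; split=> //; first by rewrite !mem_D2 n1 n2 n3 n4 n5 n6.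
  by move=> z; rewrite mem_D2 => /and3P[_ _]; apply: bxy'.
subst x'; exists x; split; rewrite ?lxy //.
- rewrite !mem_D2 n1 n2 n3 n4 xA tA' yA' !andbT; split=> //.
  by apply/andP; split; apply/eqP => e; rewrite -?e in xt ty; rklia.
- rklia.
- by rewrite (rconc_lab _ lxy).
move=> z; rewrite mem_D2 => /and3P[/eqP nzy /eqP nzt zA] xz zy' czx.
have czy : rconc z y by rewrite -(rconc_lab _ lxy).
case: (rk_neq czy nzy) => [zy|yz]; first by case: nzt; apply: bxy.
exact: bxy'.
Qed.

Lemma br_inj_first A x t y t' y' : br A x t y -> br A x t' y' ->
  t = t' /\ y = y'.
Proof.
case=> [] [xA tA yA] [xt ty] lxy [ltx ctx] bxy.
case=> [] [_ tA' yA'] [xt' ty'] lxy' [ltx' ctx'] bxy'.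
have eyy : y = y'.
  have [//|/eqP ny] := eqVneq y y'.
  have ly : rlab y = rlab y' by rewrite -lxy.
  case: (rk_neq (rconc_eqlab ly) ny) => h.
  - case: ltx'; rewrite -(bxy' y) ?(rconc_eqlab (esym lxy)) //; rklia.
  - case: ltx; rewrite -(bxy y') ?(rconc_eqlab (esym lxy')) //; rklia.
by subst y'; split=> //; apply: bxy'.
Qed.

Lemma br_inj_last A x t y x' t' : br A x t y -> br A x' t' y ->
  t = t' /\ x = x'.
Proof.
move=> b b'; have exx : x = x'; last first.
  by subst x'; case: (br_inj_first b b').
case: b b' => [] [xA tA yA] [xt ty] lxy [ltx ctx] bxy.
case=> [] [xA' tA' _] [xt' ty'] lxy' [ltx' ctx'] bxy'.
have [//|/eqP nx] := eqVneq x x'.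
have lx : rlab x = rlab x' by rewrite lxy.
case: (rk_neq (rconc_eqlab lx) nx) => h.
- case: ltx; rewrite -(bxy x') ?(rconc_eqlab (esym lx)) //; rklia.
- case: ltx'; rewrite -(bxy' x) ?(rconc_eqlab lx) //; rklia.
Qed.

(** The alternating pattern [stst]. As [y'] has the label of [t], it cannot lie between [x] and [y];
    so [y] lies between [t] and [y'] and must be [t']. *)
Lemma br_overlap A x t y t' y' : br A x t y -> br A t t' y' -> t' = y.
Proof.
case=> [] [xA tA yA] [xt ty] lxy [ltx ctx] bxy.
case=> [] [_ tA' yA'] [xt' ty'] lxy' [ltx' ctx'] bxy'.
have cy'x : rconc y' x by rewrite -(rconc_labl _ lxy').
have cyy' : rconc y y' by rewrite rconcC -(rconc_lab _ lxy).
have nyy' : y <> y' by move=> e; case: ltx; rewrite lxy' -e.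
case: (rk_neq cyy' nyy') => h.
  by symmetry; apply: bxy' => //; rewrite rconcC -(rconc_lab _ lxy).
have e := bxy y' yA' ltac:(rklia) h cy'x; rewrite e in ty'; rklia.
Qed.

Lemma br_overlap_mid A x t y x' y' : br A x t y -> br A x' y y' -> x' = t.
Proof.
case=> [] [xA tA yA] [xt ty] lxy [ltx ctx] bxy.
case=> [] [xA' _ yA'] [xt' ty'] lxy' [ltx' ctx'] bxy'.
have cx'x : rconc x' x by rewrite (rconc_lab _ lxy) rconcC.
have nx'x : x' <> x by move=> e; case: ltx'; rewrite e.
case: (rk_neq cx'x nx'x) => h; last by apply: bxy.
have exy := bxy' x xA h ltac:(rklia) ltac:(by rewrite rconcC).
rewrite exy in xt; rklia.
Qed.

(** Two different pairs around the same [t] share no endpoint. Once the first move has deleted [t],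
    nothing separates the second pair, which becomes a square. *)
Lemma br_same_mid A x t y x' y' : br A x t y -> br A x' t y' ->
  (x = x' /\ y = y') \/ exists p q, sq (A :\ t :\ y) p q.
Proof.
move=> b b'; have [exx|nx] := eqVneq x x'.
  by subst x'; left; case: (br_inj_first b b').
have [eyy|ny] := eqVneq y y'.
  by subst y'; left; case: (br_inj_last b b').
right; case: b b' => [] [xA tA yA] [xt ty] lxy [ltx ctx] bxy.
case=> [] [xA' _ yA'] [xt' ty'] lxy' [ltx' ctx'] bxy'.
exists x', y'; split=> //; try rklia.
- rewrite mem_D2 xA' andbT; apply/andP; split; apply/eqP => e;
  first by rewrite e in xt'; rklia.
  by case: ltx'; rewrite e.
- rewrite mem_D2 eq_sym ny yA' andbT; apply/eqP => e.
  by case: ltx'; rewrite lxy' e.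
- move=> z; rewrite mem_D2 => /and3P[_ /eqP nzt zA] h1 h2.
  by apply/negP => /(bxy' z zA h1 h2).
Qed.

End OneHeap.

End RankedHeaps.

Lemma card_set_ind (T : finType) (Q : {set T} -> Prop) :
  (forall A : {set T}, (forall B : {set T}, #|B| < #|A| -> Q B) -> Q A) ->
  forall A, Q A.
Proof.
move=> QI A; have [n] := ubnP #|A|; elim: n A => // n IH A /ltnSE-An.
by apply: QI => B BA; apply: IH; apply: leq_trans An.
Qed.

(** * Invariance under embeddings of ranked heaps *)

Section Transport.

Variables (P : choiceType) (C : concurrency P) (T T' : rheap C) (f : T -> T').
Implicit Types (A : {set T}) (x y t : T).

(** Ranks are preserved only as far as they compare concurrent elements, which is all that [sq] and
    [br] can detect. *)
Definition rembed A := [/\ {in A &, injective f},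
  {in A, forall a, rlab (f a) = rlab a}
  & {in A &, forall a b, rconc a b -> (rk (f a) < rk (f b)) = (rk a < rk b)}].

Lemma rembedS A A' : A' \subset A -> rembed A -> rembed A'.
Proof.
move=> /subsetP sA [fi fl fr]; split.
- by move=> a b /sA aA /sA bA; apply: fi.
- by move=> a /sA; apply: fl.
- by move=> a b /sA aA /sA bA; apply: fr.
Qed.

Lemma rembed_conc A a b : rembed A -> a \in A -> b \in A ->
  rconc (f a) (f b) = rconc a b.
Proof. by case=> _ fl _ aA bA; rewrite /rconc !fl. Qed.

Lemma rembed_sq A x y : rembed A -> x \in A -> y \in A ->
  sq (f @: A) (f x) (f y) <-> sq A x y.
Proof.
move=> fA xA yA; have [fi fl fr] := fA.
split=> [[_ _ lxy rxy bxy] | [_ _ lxy rxy bxy]].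
- have lab_xy : rlab x = rlab y by rewrite -!fl.
  split=> //; first by rewrite -fr ?rconc_eqlab.
  move=> z zA xz zy; apply/negP => czx.
  have cxz : rconc x z by rewrite rconcC.
  have czy : rconc z y by rewrite -(rconc_lab _ lab_xy).
  have := bxy (f z) (imset_f _ zA).
  by rewrite (rembed_conc fA) // czx !fr // => /(_ xz zy).
- split; rewrite ?imset_f ?fl //; first by rewrite fr ?rconc_eqlab.
  move=> _ /imsetP[z zA ->]; rewrite (rembed_conc fA) // => xz zy.
  apply/negP => czx; have cxz : rconc x z by rewrite rconcC.
  have czy : rconc z y by rewrite -(rconc_lab _ lxy).
  move: xz zy; rewrite !fr // => xz zy.
  by have := bxy z zA xz zy; rewrite czx.
Qed.

Lemma rembed_br A x t y : rembed A -> x \in A -> t \in A -> y \in A ->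
  br (f @: A) (f x) (f t) (f y) <-> br A x t y.
Proof.
move=> fA xA tA yA; have [fi fl fr] := fA.
split=> [[_ [xt ty] lxy [ltx ctx] bxy] | [_ [xt ty] lxy [ltx ctx] bxy]].
- have lab_xy : rlab x = rlab y by rewrite -!fl.
  have ctx' : rconc t x by rewrite -(rembed_conc fA).
  have ltx' : rlab t <> rlab x by rewrite -!fl.
  have cxt : rconc x t by rewrite rconcC.
  have cty : rconc t y by rewrite -(rconc_lab _ lab_xy).
  split=> //; first by rewrite -!fr.
  move=> z zA xz zy czx; apply: fi => //; apply: bxy.
  + exact: imset_f.
  + by rewrite fr // rconcC.
  + by rewrite fr // -(rconc_lab _ lab_xy).
  + by rewrite (rembed_conc fA).
- have cxt : rconc x t by rewrite rconcC.
  have cty : rconc t y by rewrite -(rconc_lab _ lxy).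
  split; rewrite ?imset_f ?fl ?(rembed_conc fA) //; first by rewrite !fr.
  move=> _ /imsetP[z zA ->] xz zy; rewrite (rembed_conc fA) // => czx.
  congr f; apply: bxy => //.
  + by rewrite -fr // rconcC.
  + by rewrite -fr // -(rconc_lab _ lxy).
Qed.

Lemma reduced_imset A : rembed A -> reduced (f @: A) <-> reduced A.
Proof.
move=> fA; split=> [[sqA brA] | [sqA brA]]; split.
- move=> x y s; case: (s) => xA yA _ _ _.
  by apply: (sqA (f x) (f y)); apply/(rembed_sq fA).
- move=> x t y s; case: (s) => [] [xA tA yA] _ _ _ _.
  by apply: (brA (f x) (f t) (f y)); apply/(rembed_br fA).
- move=> x y s; case: (s) => /imsetP[x' xA ex] /imsetP[y' yA ey] _ _ _.
  by rewrite ex ey in s; apply: (sqA x' y'); apply/(rembed_sq fA).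
- move=> x t y s.
  case: (s) => [] [/imsetP[x' xA ex] /imsetP[t' tA et] /imsetP[y' yA ey]] _ _ _ _.
  by rewrite ex et ey in s; apply: (brA x' t' y'); apply/(rembed_br fA).
Qed.

Lemma imset_D1 A t : rembed A -> t \in A -> f @: (A :\ t) = f @: A :\ f t.
Proof.
case=> fi _ _ tA; apply/setP => z; rewrite in_setD1; apply/imsetP/andP.
  case=> w /setD1P[wt wA] ->; split; last exact: imset_f.
  by apply: contra wt => /eqP/fi->.
case=> zt /imsetP[w wA ew]; exists w; rewrite // in_setD1 wA andbT.
by apply: contraNneq zt => <-; rewrite ew.
Qed.

Lemma imset_D2 A t y : rembed A -> t \in A -> y \in A -> t != y ->
  f @: (A :\ t :\ y) = f @: A :\ f t :\ f y.
Proof.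
move=> fA tA yA ty; rewrite -imset_D1 // imset_D1 //.
  by apply: rembedS fA; apply: subsetDl.
by rewrite !inE eq_sym ty yA.
Qed.

Lemma br_neq A x t y : br A x t y -> t != y.
Proof. by case=> _ [_ ty] _ _ _; apply/eqP => e; move: ty; rewrite e ltnn. Qed.

Lemma alive_imset A : rembed A -> alive (f @: A) <-> alive A.
Proof.
elim/card_set_ind: A => A IH fA.
have IH' x t y : br A x t y -> alive (f @: A :\ f t :\ f y) <-> alive (A :\ t :\ y).
  move=> b; case: (b) => [] [xA tA yA] _ _ _ _.
  have sA : A :\ t :\ y \subset A by rewrite !subDset; apply/subsetP => z;
    rewrite !inE => ->; rewrite !orbT.
  rewrite -imset_D2 //; last exact: br_neq b.
  apply: IH; last exact: rembedS fA.
  by apply: proper_card; apply/properP; split=> //; exists t;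
    rewrite ?mem_D2 ?eqxx ?andbF.
split=> aA; apply: alive_intro.
- move=> x y s; case: (s) => xA yA _ _ _.
  by apply: (alive_sq aA (x := f x) (y := f y)); apply/(rembed_sq fA).
- move=> x t y s; apply/(IH' _ _ _ s); case: (s) => [] [xA tA yA] _ _ _ _.
  by apply: (alive_br (x := f x) aA); apply/(rembed_br fA).
- move=> x y s; case: (s) => /imsetP[x' xA ex] /imsetP[y' yA ey] _ _ _.
  by rewrite ex ey in s; apply: (alive_sq aA (x := x') (y := y'));
    apply/(rembed_sq fA).
- move=> x t y s.
  case: (s) => [] [/imsetP[x' xA ex] /imsetP[t' tA et] /imsetP[y' yA ey]] _ _ _ _.
  rewrite ex et ey in s *; have b : br A x' t' y' by apply/(rembed_br fA).
  by apply/(IH' _ _ _ b); apply: alive_br aA b.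
Qed.

End Transport.

(** * Aliveness is invariant under braid moves *)

Section Confluence.

Variables (P : choiceType) (C : concurrency P) (T : rheap C).
Implicit Types (A : {set T}) (x y t : T).

(** Shortening [sts] to its first or to its last [s] gives the same heap: without [t], nothing
    concurrent with [x] lies between [x] and [y], so [y] can be slid down to the place of [x]. *)
Lemma alive_swap A x t y : br A x t y ->
  alive (A :\ x :\ t) <-> alive (A :\ t :\ y).
Proof.
move=> b; case: (b) => [] [xA tA yA] [xt ty] lxy [ltx ctx] bxy.
have xy : x != y by apply/eqP => e; rewrite e in xt; rklia.
have ntx : t != x by apply/eqP => e; case: ltx; rewrite e.
have nty := br_neq b.
pose f z := if z == y then x else z.
have -> : A :\ t :\ y = f @: (A :\ x :\ t).
  apply/setP => z; rewrite mem_D2; apply/idP/imsetP => [/and3P[zy zt zA] | [w]].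
    have [->|zx] := eqVneq z x; last first.
      by exists z; rewrite ?mem_D2 ?zx ?zt // /f (negPf zy).
    by exists y; rewrite /f ?eqxx // mem_D2 yA andbT eq_sym nty eq_sym.
  rewrite mem_D2 /f => /and3P[wt wx wA] ->; have [_|wy] := eqVneq w y.
    by rewrite xy xA eq_sym ntx.
  by rewrite wy wt.
symmetry; apply: alive_imset; split.
- move=> a c; rewrite !mem_D2 /f => /and3P[at' ax aA] /and3P[ct cx cA].
  case: eqVneq => [->|ay]; case: eqVneq => [->|cy] //.
    by move=> e; rewrite -e eqxx in cx.
  by move=> e; rewrite e eqxx in ax.
- by move=> a _; rewrite /f; case: eqVneq => [->|].
have cmp z : z \in A :\ x :\ t -> z != y -> rconc z x ->
    (rk x < rk z) = (rk y < rk z) /\ (rk z < rk x) = (rk z < rk y).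
  rewrite mem_D2 => /and3P[/eqP zt /eqP zx zA] /eqP zy cz.
  have cy : rconc z y by rewrite -(rconc_lab _ lxy).
  case: (rk_neq cz zx) => h1; case: (rk_neq cy zy) => h2.
  - by split; rklia.
  - by split; rklia.
  - by case: zt; apply: bxy.
  - by split; rklia.
move=> a c aA cA cac; rewrite /f.
case: eqVneq => [ea|ay]; case: eqVneq => [ec|cy] //.
- by rewrite ea ec !ltnn.
- by have [-> _] := cmp c cA cy ltac:(by rewrite rconcC (rconc_labl _ lxy) -ea);
  rewrite ea.
- by have [_ ->] := cmp a aA ay ltac:(by rewrite (rconc_lab _ lxy) -ec); rewrite ec.
Qed.

Lemma setD2C A t y t' y' : A :\ t :\ y :\ t' :\ y' = A :\ t' :\ y' :\ t :\ y.
Proof. by apply/setP => z; rewrite !inE; case: (z == t); case: (z == y);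
  case: (z == t'); case: (z == y'). Qed.

(* Local confluence: two braid reductions of [A] commute, agree up to the
   relabelling of [alive_swap], or both produce a square. *)
Lemma alive_expand A x t y : br A x t y -> alive (A :\ t :\ y) -> alive A.
Proof.
elim/card_set_ind: A x t y => A IH x t y b aA.
apply: alive_intro => [p q s | x' t' y' b'].
  by have [p' [q' /(alive_sq aA)]] := sq_braid s b.
have [et|/eqP nt] := eqVneq t t'.
  rewrite -et in b' *; case: (br_same_mid b b') => [[_ <-//]|[p [q]]].
  by move/(alive_sq aA).
(* In the pattern [stst], formed by [x], [t], [y], [y'], the two moves leave heaps that differ only
   by sliding [y'] down to [t]. *)
have [e1|/eqP n1] := eqVneq x' t.
  rewrite e1 in b'; have e2 := br_overlap b b'; rewrite e2 in b' *.
  exact/(alive_swap b').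
have [e1|/eqP n2] := eqVneq t' y.
  by rewrite e1 in b'; case: n1; apply: br_overlap_mid b b'.
have [e1|/eqP n3] := eqVneq x t'.
  rewrite -e1 in b' *; have e2 := br_overlap b' b.
  by rewrite -e2; apply/(alive_swap b).
have [e1|/eqP n4] := eqVneq t y'.
  by rewrite e1 in b; case: n3; apply: br_overlap_mid b' b.
have n5 : y <> y' by move=> e; rewrite -e in b'; case: nt; case: (br_inj_last b b').
(* All overlaps are excluded, so each move remains possible after the other. Both orders lead to the
   same set, and the induction hypothesis applies to [A :\ t' :\ y']. *)
have [x1 b1] := br_commute b b' (nesym nt) n2 (nesym n4) (nesym n5) n1.
have [x2 b2] := br_commute b' b nt n4 (nesym n2) n5 n3.
apply: (IH _ _ x2 t y b2); last by rewrite setD2C; apply: alive_br aA b1.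
apply: proper_card; apply/properP; case: (b') => [] [_ tA _] _ _ _ _.
split; last by exists t'; rewrite // mem_D2 eqxx andbF.
by apply/subsetP => z; rewrite mem_D2 => /and3P[].
Qed.

Lemma alive_brE A x t y : br A x t y -> alive A <-> alive (A :\ t :\ y).
Proof. by move=> b; split=> [/alive_br|]; [apply;
  exact: b | exact: alive_expand b]. Qed.

End Confluence.

(** * The opposite heap *)

Section Reversal.

Variables (P : choiceType) (C : concurrency P) (T : rheap C).
Implicit Types (A : {set T}) (a b x y t z : T).

Definition rk_max := \max_(a : T) rk a.

Lemma rk_le_max a : rk a <= rk_max.
Proof. exact: leq_bigmax. Qed.

Definition rev_rk a := rk_max - rk a.

Lemma rev_rk_inj a b : C (rlab a) (rlab b) -> rev_rk a = rev_rk b -> a = b.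
Proof.
move=> cab e; apply: (rk_inj cab).
by have := rk_le_max a; have := rk_le_max b; move: e; rewrite /rev_rk; lia.
Qed.

Definition rrev : rheap C := RHeap rev_rk_inj.

Lemma rev_rkE a b : (rk (a : rrev) < rk (b : rrev)) = (rk b < rk a).
Proof.
by have := rk_le_max a; have := rk_le_max b; rewrite /= /rev_rk; lia.
Qed.

Lemma rev_rk_leE a b : (rk (a : rrev) <= rk (b : rrev)) = (rk b <= rk a).
Proof. by rewrite leqNgt rev_rkE -leqNgt. Qed.

Lemma sq_rev A x y : sq (A : {set rrev}) x y <-> sq A y x.
Proof.
split=> -[] xA yA lxy rxy bxy; split; rewrite ?rev_rkE // in rxy *.
  by move=> z zA h1 h2; have := bxy z zA; rewrite !rev_rkE h1 h2 /rconc lxy; apply.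
move=> z zA; rewrite !rev_rkE => h1 h2; have := bxy z zA h2 h1.
by rewrite /rconc lxy.
Qed.

Lemma br_rev A x t y : br (A : {set rrev}) x t y <-> br A y t x.
Proof.
split=> -[] [xA tA yA] rxy lxy [ltx ctx] bxy; split; rewrite ?rev_rkE // in rxy *.
- by case: rxy.
- by rewrite -(lxy : rlab (x : T) = rlab (y : T)) -(rconc_lab _ (lxy : rlab (x :
  T) = _)).
- move=> z zA h1 h2 czy; apply: bxy; rewrite ?rev_rkE //.
  by rewrite /rconc lxy.
- by case: rxy.
- by rewrite /rconc /= -lxy.
- move=> z zA; rewrite !rev_rkE => h1 h2 czx; apply: bxy => //.
  by rewrite (rconc_lab _ lxy).
Qed.

Lemma reduced_rev A : reduced (A : {set rrev}) <-> reduced A.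
Proof.
split=> -[sqA brA]; split=> [x y /sq_rev | x t y /br_rev];
  by [apply: sqA | apply: brA].
Qed.

End Reversal.

(** * Maximal and minimal elements *)

Section Tops.

Variables (P : choiceType) (C : concurrency P).

Definition rtop (T : rheap C) (A : {set T}) (a : T) :=
  forall z, z \in A -> rconc z a -> rk z <= rk a.

(** A maximal element never separates two concurrent elements with equal labels, so its deletion
    creates neither a square nor a braid chain. *)
Lemma reduced_top (T : rheap C) (A : {set T}) a :
  reduced A -> rtop A a -> reduced (A :\ a).
Proof.
move=> [sqA brA] ta; split.
- move=> x y [] /setD1P[xa xA] /setD1P[ya yA] lxy rxy bxy.
  apply: (sqA x y); split=> // z zA h1 h2; apply/negP => czx.
  have [ez|nz] := eqVneq z a; last by have := bxy z;
    rewrite in_setD1 nz zA czx h1 h2 => /(_ isT isT isT).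
  by have := ta y yA; rewrite -ez -(rconc_labl _ lxy) rconcC czx leqNgt h2 =>
    /(_ isT).
- move=> x t y [] [] /setD1P[xa xA] /setD1P[ta' tA] /setD1P[ya yA] rxy lxy ltx bxy.
  apply: (brA x t y); split=> // z zA h1 h2 czx.
  have [ez|nz] := eqVneq z a; last by apply: bxy; rewrite // in_setD1 nz.
  by have := ta y yA; rewrite -ez -(rconc_labl _ lxy) rconcC czx leqNgt h2 =>
    /(_ isT).
Qed.

(* [a] is maximal and removing it exposes [b]: the relation E(a) <+ E. *)
Definition rprec (T : rheap C) (A : {set T}) (a b : T) :=
  [/\ a \in A /\ b \in A, rtop A a, rk b < rk a, rconc b a /\ rlab b <> rlab a
    & forall z, z \in A -> rconc z b -> rk b < rk z -> z = a].

Definition tops (T : rheap C) : {set T} :=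
  [set a | [forall z, rconc z a ==> (rk z <= rk a)]].
Definition bottoms (T : rheap C) : {set T} :=
  [set a | [forall z, rconc z a ==> (rk a <= rk z)]].

Lemma topsP (T : rheap C) (a : T) :
  reflect (forall z, rconc z a -> rk z <= rk a) (a \in tops T).
Proof. by rewrite inE; apply: (iffP forallP) => h z; apply/implyP; apply: h. Qed.

Lemma bottomsP (T : rheap C) (a : T) :
  reflect (forall z, rconc z a -> rk a <= rk z) (a \in bottoms T).
Proof. by rewrite inE; apply: (iffP forallP) => h z; apply/implyP; apply: h. Qed.

Lemma topsN (T : rheap C) (a : T) :
  a \notin tops T -> exists2 z, rconc z a & rk a < rk z.
Proof.
rewrite inE negb_forall => /existsP[z]; rewrite negb_imply -ltnNge => /andP[].
by exists z.
Qed.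

End Tops.

(** * Gluing a heap to its mirror image *)

Section Doubling.

Variables (P : choiceType) (C : concurrency P) (T : rheap C).
Implicit Types (U M : {set T}) (a b m x y t z : T).

Definition dlab (u : T + T) : P := match u with inl a | inr a => rlab a end.
(** Ranks in the mirrored copy are at least [rk_max T + 1], hence above the whole first copy, and
    run in the opposite order. *)
Definition drk (u : T + T) : nat :=
  match u with inl a => rk a | inr a => (rk_max T).*2.+1 - rk a end.

Lemma drk_inj u v : C (dlab u) (dlab v) -> drk u = drk v -> u = v.
Proof.
case: u v => [a|a] [b|b] /= cab e;
  have := rk_le_max a; have := rk_le_max b => hb ha.
- by congr inl; apply: rk_inj.
- lia.
- lia.
- by congr inr; apply: (rk_inj cab); lia.
Qed.

Definition rdouble : rheap C := RHeap drk_inj.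

Lemma drk_ll a b : (rk (inl a : rdouble) < rk (inl b : rdouble)) = (rk a < rk b).
Proof. by []. Qed.

Lemma drk_rr a b : (rk (inr a : rdouble) < rk (inr b : rdouble)) = (rk b < rk a).
Proof. by have := rk_le_max a; have := rk_le_max b; rewrite /=; lia. Qed.

Lemma drk_lr a b : rk (inl a : rdouble) < rk (inr b : rdouble).
Proof. by have := rk_le_max a; have := rk_le_max b; rewrite /=; lia. Qed.

Lemma drk_rl a b : (rk (inr a : rdouble) < rk (inl b : rdouble)) = false.
Proof. by have := rk_le_max a; have := rk_le_max b; rewrite /=; lia. Qed.

Definition drkE := (drk_ll, drk_rr, drk_lr, drk_rl).

(* The heap [U o M o U^op]. *)
Definition dset U M : {set rdouble} :=
  [set u : T + T | match u with inl a => a \in U :|: M | inr a => a \in U end].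

Lemma dset_l U M a : ((inl a : rdouble) \in dset U M) = (a \in U :|: M).
Proof. by rewrite inE. Qed.

Lemma dset_r U M a : ((inr a : rdouble) \in dset U M) = (a \in U).
Proof. by rewrite inE. Qed.

(** [M] consists of pairwise non-concurrent maximal elements of [U :|: M], but need not contain all
    maximal elements: deleting one from the middle layer may expose elements of [U]. *)
Definition layered U M := forall m, m \in M -> m \notin U /\
  forall z, z \in U :|: M -> rconc z m -> z <> m -> z \in U /\ rk z < rk m.

Lemma layered_top U M m z : layered U M -> m \in M -> z \in U :|: M ->
  rconc z m -> rk m < rk z -> False.
Proof.
move=> lay mM zUM czm mz; have [_ h] := lay m mM.
have zm : z <> m by move=> e; rewrite e ltnn in mz.
by have [_] := h z zUM czm zm; rklia.
Qed.

(** An element of [U] with nothing concurrent above it meets its own mirror image. *)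
Lemma dsq_lr U M x : x \in U ->
  (forall z, z \in U :|: M -> rconc z x -> rk z <= rk x) ->
  sq (dset U M) (inl x) (inr x).
Proof.
move=> xU bx; split; rewrite ?dset_l ?dset_r ?drkE ?in_setU ?xU //.
case=> z; rewrite ?dset_l ?dset_r !drkE => zA h1 h2.
- by apply: contraTN h1 => /(bx z zA); rewrite -leqNgt.
- by apply: contraTN h2 => /(bx z _); rewrite -leqNgt; apply; rewrite in_setU zA.
Qed.

(** A square inside one half, or with an end in [M], reflects to a square of [U :|: M]. A square
    joining two elements of [U] across the middle must join copies of the same element, since
    otherwise a copy of the one of larger rank would lie in between. *)
Lemma dsq U M (p q : rdouble) : layered U M -> sq (dset U M) p q ->
  (exists x y, sq (U :|: M) x y) \/
  exists2 x, x \in U & forall z, z \in U :|: M -> rconc z x -> rk z <= rk x.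
Proof.
move=> lay; case: p q => [p|p] [q|q] []; rewrite ?dset_l ?dset_r => pA qA lpq;
  have {}lpq : rlab p = rlab q := lpq; rewrite ?drkE // => rpq bpq.
- by left; exists p, q; split=> // z zA h1 h2; apply: (bpq (inl z));
  rewrite ?dset_l.
- have [pM|pM] := boolP (p \in M).
    left; exists q, p; have qUM : q \in U :|: M by rewrite in_setU qA.
    have qp : q <> p by move=> e; case: (lay p pM); rewrite -e qA.
    have [_ rqp] := (lay p pM).2 q qUM (rconc_eqlab (esym lpq)) qp.
    split=> // z zA h1 h2; apply/negP => czq.
    move: zA; rewrite in_setU => /orP[zU|zM].
      by have := bpq (inr z);
        rewrite dset_r !drkE zU h1 (_ : rconc _ _) => [/(_ isT isT isT)//|];
          rewrite /rconc /= lpq.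
    by apply: (layered_top lay zM pA _ h2); rewrite (rconc_labl _ lpq) rconcC.
  right; exists q => // z zA czq; rewrite leqNgt; apply/negP => qz.
  have pU : p \in U by move: pA; rewrite in_setU (negPf pM) orbF.
  have epq : p = q.
    have [//|/eqP npq] := eqVneq p q.
    case: (rk_neq (rconc_eqlab lpq) npq) => h.
      have := bpq (inl q); rewrite dset_l !drkE in_setU qA h =>
        /(_ isT isT isT)/negP[].
      by rewrite /rconc /= lpq conc_refl.
    have := bpq (inr p); rewrite dset_r !drkE pU h => /(_ isT isT isT)/negP[].
    by rewrite /rconc /= conc_refl.
  subst q; have := bpq (inl z);
    rewrite dset_l !drkE zA qz => /(_ isT isT isT)/negP[].
  exact: czq.
- left; exists q, p; split; rewrite ?in_setU ?pA ?qA // => z zA h1 h2.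
  apply/negP => czq; move: zA; rewrite in_setU => /orP[zU|zM].
    have := bpq (inr z); rewrite dset_r !drkE zU h1 h2 => /(_ isT isT isT)/negP[].
    by rewrite /rconc /= lpq.
  apply: (layered_top lay zM (z := p)) => //; first by rewrite in_setU pA.
  by rewrite (rconc_labl _ lpq) rconcC.
Qed.

(** As for squares, a braid chain that does not reflect into one half joins the two copies of some
    [x] in [U]. Its middle element belongs to [M], because an element of [U] would occur twice
    between the copies. *)
Lemma dbr U M (p t q : rdouble) : layered U M -> br (dset U M) p t q ->
  (exists x t y, br (U :|: M) x t y) \/
  exists x m, [/\ x \in U /\ m \in M, rk x < rk m, rconc m x, rlab m <> rlab x
    & forall z, z \in U :|: M -> rconc z x -> rk x < rk z -> z = m].
Proof.
move=> lay; case: p t q => [p|p] [t|t] [q|q] [] []; rewrite ?dset_l ?dset_r;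
  rewrite ?drkE => pA tA qA [] // rpt rtq lpq /= [ltp ctp] bpq;
  have {}lpq : rlab p = rlab q := lpq.
- left; exists p, t, q; split=> // z zA h1 h2 czp.
  by have := bpq (inl z); rewrite dset_l !drkE => /(_ zA h1 h2 czp) [].
- have [pM|pM] := boolP (p \in M).
    by have := layered_top lay pM tA ctp rpt.
  have pU : p \in U by move: pA; rewrite in_setU (negPf pM) orbF.
  right; exists p, t.
  have epq : p = q.
    have [//|/eqP npq] := eqVneq p q.
    have cqp : rconc q p by apply: rconc_eqlab.
    case: (rk_neq (rconc_eqlab lpq) npq) => h.
      have := bpq (inl q); rewrite dset_l !drkE in_setU qA h =>
        /(_ isT isT isT cqp) [e].
      by case: ltp; rewrite -e.
    have := bpq (inr p); rewrite dset_r !drkE pU h => /(_ isT isT isT) h'.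
    by have := h' (conc_refl _ _).
  subst q; split=> //.
    split=> //; move: tA; rewrite in_setU => /orP[tU|//].
    by have := bpq (inr t); rewrite dset_r !drkE tU rpt => /(_ isT isT isT ctp).
  move=> z zA czp pz; have := bpq (inl z); rewrite dset_l !drkE zA pz.
  by move=> /(_ isT isT isT czp) [].
- have [pM|pM] := boolP (p \in M).
    left; exists q, t, p; have qUM : q \in U :|: M by rewrite in_setU qA.
    have qp : q <> p by move=> e; case: (lay p pM); rewrite -e qA.
    have tUM : t \in U :|: M by rewrite in_setU tA.
    have tp : t <> p by move=> e; case: ltp; rewrite e.
    have [_ rqp] := (lay p pM).2 q qUM (rconc_eqlab (esym lpq)) qp.
    have [_ rtp] := (lay p pM).2 t tUM ctp tp.
    split=> //; first by rewrite -lpq; split=> //; rewrite -(rconc_lab _ lpq).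
    move=> z zA h1 h2 czq; move: zA; rewrite in_setU => /orP[zU|zM].
      have czp : rconc z p by rewrite (rconc_lab _ lpq).
      by have := bpq (inr z); rewrite dset_r !drkE zU h1 => /(_ isT isT isT czp) [].
    exfalso; apply: (layered_top lay zM pA _ h2).
    by rewrite (rconc_labl _ lpq) rconcC.
  have pU : p \in U by move: pA; rewrite in_setU (negPf pM) orbF.
  have epq : p = q.
    have [//|/eqP npq] := eqVneq p q.
    have cqp : rconc q p by apply: rconc_eqlab.
    case: (rk_neq (rconc_eqlab lpq) npq) => h.
      by have := bpq (inl q);
        rewrite dset_l !drkE in_setU qA h => /(_ isT isT isT cqp).
    have := bpq (inr p); rewrite dset_r !drkE pU h => /(_ isT isT isT) h'.
    by have [e] := h' (conc_refl _ _); case: ltp; rewrite e.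
  subst q; have := bpq (inl t); rewrite dset_l !drkE in_setU tA rtq.
  by move=> /(_ isT isT isT ctp).
- left; exists q, t, p; split; rewrite ?in_setU ?pA ?qA ?tA //.
    by rewrite -lpq; split=> //; rewrite -(rconc_lab _ lpq).
  move=> z zA h1 h2 czq; move: zA; rewrite in_setU => /orP[zU|zM].
    have czp : rconc z p by rewrite (rconc_lab _ lpq).
    by have := bpq (inr z);
      rewrite dset_r !drkE zU h1 h2 => /(_ isT isT isT czp) [].
  exfalso; apply: (layered_top lay zM (z := p)) => //; first by rewrite in_setU pA.
  by rewrite (rconc_labl _ lpq) rconcC.
Qed.

End Doubling.

(** * Counting minimal and maximal elements by symmetric reductions *)

Section Peeling.

Variables (P : choiceType) (C : concurrency P) (T : rheap C).
Implicit Types (U M : {set T}) (a b m x y t z : T).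

Lemma not_bottom x y : rconc x y -> rk x < rk y -> y \notin bottoms T.
Proof. by move=> cxy xy; apply/negP => /bottomsP/(_ x cxy); rklia. Qed.

(* [.. x t y .. M .. y t x ..] -> [.. x .. M .. x ..] *)
Lemma dset_reflect U M x t y : layered U M -> br (U :|: M) x t y -> y \in U ->
  alive (dset U M) -> alive (dset (U :\ t :\ y) M) /\ layered (U :\ t :\ y) M.
Proof.
move=> lay b yU aUM; case: (b) => [] [xA tA yA] [xt ty] lxy [ltx ctx] bxy.
have low z : z \in U :|: M -> rconc z y -> rk z < rk y -> z \in U.
  rewrite in_setU => /orP[//|zM] czy zy.
  by have := layered_top lay zM yA ltac:(by rewrite rconcC) zy.
have tU : t \in U by apply: low => //; rewrite -(rconc_lab _ lxy).
have xU : x \in U by apply: low; [|exact: rconc_eqlab|rklia].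
have nty := br_neq b.
have b1 : br (dset U M) (inl x) (inl t) (inl y).
  split; rewrite ?dset_l // ?drkE //.
  by case=> z; rewrite ?dset_l !drkE // => zA h1 h2 czx; congr inl; apply: bxy.
set A1 := dset U M :\ inl t :\ inl y.
have memr z : (inr z : rdouble T) \in A1 = (z \in U) by rewrite mem_D2 dset_r.
have b2 : br A1 (inr y) (inr t) (inr x).
  split; rewrite ?memr ?drkE //.
    by split; [rewrite /= -lxy | rewrite /rconc /= -lxy].
  case=> z; rewrite ?memr ?drkE // => zU h1 h2 czy; congr inr; apply: bxy => //.
    by rewrite in_setU zU.
  by rewrite (rconc_lab _ lxy).
have eA : dset (U :\ t :\ y) M = A1 :\ inr y :\ inr t.
  have dM z : z \in U -> z \in M = false.
    by move=> zU; apply/negP => /lay[]; rewrite zU.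
  apply/setP => -[] z; rewrite !in_setD1 ?dset_l ?dset_r ?in_setU !in_setD1.
    rewrite !(inj_eq (@inl_inj _ _)) /=.
    have [->|zy] := eqVneq z y; first by rewrite dM.
    by have [->|//] := eqVneq z t; rewrite dM.
  by rewrite !(inj_eq (@inr_inj _ _)) /=; case: (z == t); case: (z == y).
split.
  (* The mirrored move deletes the copies of [t] and [x]; [alive_swap] trades [x] for [y], so that
     the halves stay mirror images. *)
  by rewrite eA; apply/(alive_swap b2); apply: (alive_br (alive_br aUM b1) b2).
move=> m mM; have [mU lm] := lay m mM; split.
  by rewrite !inE (negPf mU) !andbF.
move=> z; rewrite in_setU => zA czm nzm.
have zA' : z \in U :|: M.
  by move: zA; rewrite in_setU => /orP[|->];
    rewrite ?orbT // !in_setD1 => /and3P[_ _ ->].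
have [zU zm] := lm z zA' czm nzm; split=> //; rewrite !in_setD1.
case/orP: zA; first by rewrite !in_setD1.
by move=> zM; have [] := lay z zM; rewrite zU.
Qed.

(* [.. x t m t x ..] -> [.. x ..], with [x] joining the middle layer. *)
Lemma dset_absorb U M x t m : layered U M -> br (U :|: M) x t m -> m \in M ->
  alive (dset U M) ->
  alive (dset (U :\ t :\ x) (x |: M :\ m)) /\ layered (U :\ t :\ x) (x |: M :\ m).
Proof.
move=> lay b mM aUM; case: (b) => [] [xA tA yA] [xt ty] lxy [ltx ctx] bxy.
have [mU lm] := lay m mM.
have ctm : rconc t m by rewrite -(rconc_lab _ lxy).
have ntm := br_neq b.
have [tU _] := lm t tA ctm (elimN eqP ntm).
have nxm : x <> m by move=> e; rewrite e in xt; rklia.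
have [xU _] := lm x xA (rconc_eqlab lxy) nxm.
have ntx : t <> x by move=> e; case: ltx; rewrite e.
have xM : x \notin M by apply/negP => /lay[]; rewrite xU.
have tM : t \notin M by apply/negP => /lay[]; rewrite tU.
have above z : z \in U :|: M -> rconc z x -> rk x < rk z -> z = t \/ z = m.
  move=> zA czx xz; have czm : rconc z m by rewrite -(rconc_lab _ lxy).
  have [->|/eqP nzm] := eqVneq z m; [by right|left].
  by have [_ zm] := lm z zA czm nzm; apply: bxy.
have b1 : br (dset U M) (inl x) (inl t) (inl m).
  split; rewrite ?dset_l // ?drkE //.
  by case=> z; rewrite ?dset_l !drkE // => zA h1 h2 czx; congr inl; apply: bxy.
set A1 := dset U M :\ inl t :\ inl m.
have memr z : (inr z : rdouble T) \in A1 = (z \in U) by rewrite mem_D2 dset_r.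
have meml z : (inl z : rdouble T) \in A1 = [&& z != m, z != t & z \in U :|: M].
  by rewrite mem_D2 dset_l !(inj_eq (@inl_inj _ _)).
(* With [t] and [m] gone from the lower half, only the mirrored [t] separates the two copies of
   [x]. *)
have b2 : br A1 (inl x) (inr t) (inr x).
  split; rewrite ?memr ?drkE //.
    by rewrite meml xA andbT; split=> //; apply/andP; split; apply/eqP => // /esym.
  case=> z; rewrite ?memr ?meml ?drkE // => zA h1 h2 czx.
    case/and3P: zA => /eqP zm /eqP zt zA; case: (above z) => //.
  have zA' : z \in U :|: M by rewrite in_setU zA.
  case: (above z zA' czx) => // [->|ez] //.
  by case/negP: mU; rewrite -ez.
have eA : dset (U :\ t :\ x) (x |: M :\ m) = A1 :\ inr t :\ inr x.
  apply/setP => -[] z; rewrite !in_setD1 ?dset_l ?dset_r ?in_setU !in_setD1.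
    rewrite in_set1 !(inj_eq (@inl_inj _ _)) /=.
    have [->|zx] := eqVneq z x.
      by rewrite /= xU orTb !andbT; symmetry; apply/andP; split;
        apply/eqP => // /esym.
    have [->|zt] := eqVneq z t; first by rewrite /= (negPf tM) ?andbF.
    have [->|zm] := eqVneq z m; first by rewrite /= (negPf mU).
    by [].
  by rewrite !(inj_eq (@inr_inj _ _)) /=.
split; first by rewrite eA; apply: (alive_br (alive_br aUM b1) b2).
have sub z : z \in U :\ t :\ x :|: (x |: M :\ m) ->
    [/\ z \in U :|: M, z != t & z != m].
  rewrite !(in_setU, in_setD1, in_set1) =>
    /or3P[/and3P[zx zt zU]|/eqP->|/andP[zm zM]].
  - by rewrite zU zt; split=> //; apply: contraNneq mU => <-.
  - by rewrite xU; split=> //; apply/eqP => // /esym.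
  - by rewrite zM orbT zm; split=> //; apply: contraNneq tM => <-.
move=> m'; rewrite in_setU1 in_setD1 => /orP[/eqP->|/andP[m'm m'M]].
  split; first by rewrite !inE eqxx.
  move=> z /[dup] zA' /sub[zA /eqP zt /eqP zm] czx nzx.
  case: (rk_neq czx nzx) => h; last by case: (above z zA czx h).
  split=> //; move: zA'; rewrite !(in_setU, in_setD1, in_set1).
  case/or3P=> [//|/eqP//|/andP[_ zM]].
  by have := layered_top lay zM xA ltac:(by rewrite rconcC) h.
have [m'U lm'] := lay m' m'M; split; first by rewrite !inE (negPf m'U) !andbF.
move=> z /[dup] zA' /sub[zA /eqP zt /eqP zm] czm' nzm'.
have [zU zm'] := lm' z zA czm' nzm'; split=> //.
move: zA'; rewrite !(in_setU, in_setD1, in_set1).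
case/or3P=> [//|/eqP ez|/andP[_ zM]]; last by case: (lay z zM); rewrite zU.
subst z; have cm'm : rconc m' m by rewrite -(rconc_lab _ lxy) rconcC.
have m'A : m' \in U :|: M by rewrite in_setU m'M orbT.
by have [] := lm m' m'A cm'm (elimN eqP m'm); rewrite (negPf m'U).
Qed.

(* [.. x m x ..] -> [.. x ..], with [x] joining the middle layer. *)
Lemma dset_exchange U M x m : layered U M -> x \in U -> m \in M ->
  rk x < rk m -> rconc m x -> rlab m <> rlab x ->
  (forall z, z \in U :|: M -> rconc z x -> rk x < rk z -> z = m) ->
  alive (dset U M) ->
  alive (dset (U :\ x) (x |: M :\ m)) /\ layered (U :\ x) (x |: M :\ m).
Proof.
move=> lay xU mM xm cmx lmx uniq_m aUM.
have [mU lm] := lay m mM.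
have xA : x \in U :|: M by rewrite in_setU xU.
have mA : m \in U :|: M by rewrite in_setU mM orbT.
have xM : x \notin M by apply/negP => /lay[]; rewrite xU.
have nmx : m != x by apply: contraNneq xM => <-.
have b : br (dset U M) (inl x) (inl m) (inr x).
  split; rewrite ?dset_l ?dset_r ?drkE //.
  case=> z; rewrite ?dset_l ?dset_r !drkE // => zA h1 h2 czx.
    by congr inl; apply: uniq_m.
  have zA' : z \in U :|: M by rewrite in_setU zA.
  by case/negP: mU; rewrite -(uniq_m z zA' czx h2).
have eA : dset (U :\ x) (x |: M :\ m) = dset U M :\ inl m :\ inr x.
  apply/setP => -[] z; rewrite !in_setD1 ?dset_l ?dset_r ?in_setU ?in_set1
    !in_setD1.
    rewrite !(inj_eq (@inl_inj _ _)) /=.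
    have [->|zx] := eqVneq z x; first by rewrite /= xU eq_sym nmx.
    by have [->|zm] := eqVneq z m; first by rewrite /= (negPf mU).
  by rewrite !(inj_eq (@inr_inj _ _)) /=.
split; first by rewrite eA; apply: alive_br aUM b.
have sub z : z \in U :\ x :|: (x |: M :\ m) -> z \in U :|: M /\ z != m.
  rewrite !(in_setU, in_setD1, in_set1) => /or3P[/andP[zx zU]|/eqP->|/andP[zm zM]].
  - by rewrite zU; split=> //; apply: contraNneq mU => <-.
  - by rewrite xU eq_sym.
  - by rewrite zM orbT zm.
move=> m'; rewrite in_setU1 in_setD1 => /orP[/eqP->|/andP[m'm m'M]].
  split; first by rewrite !inE eqxx.
  move=> z /[dup] zA' /sub[zA /eqP zm] czx nzx.
  case: (rk_neq czx nzx) => h; last by case: zm; apply: uniq_m.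
  split=> //; move: zA'; rewrite !(in_setU, in_setD1, in_set1).
  case/or3P=> [//|/eqP//|/andP[_ zM]].
  by have := layered_top lay zM xA ltac:(by rewrite rconcC) h.
have [m'U lm'] := lay m' m'M; split; first by rewrite !inE (negPf m'U) !andbF.
move=> z /[dup] zA' /sub[zA /eqP zm] czm' nzm'.
have [zU zm'] := lm' z zA czm' nzm'; split=> //.
move: zA'; rewrite !(in_setU, in_setD1, in_set1).
case/or3P=> [//|/eqP ez|/andP[_ zM]]; last by case: (lay z zM); rewrite zU.
subst z; case/eqP: m'm; apply: uniq_m => //; first by rewrite in_setU m'M orbT.
by rewrite rconcC.
Qed.

(** While a braid chain remains, one of the three symmetric moves applies. Each shrinks [U] and
    keeps the size of the middle layer. Elements lost from [U :|: M] have a concurrent element below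
    them in [T], so no minimal element of [T] is lost. *)
Lemma dset_normalize U M : layered U M -> alive (dset U M) ->
    bottoms T \subset U :|: M ->
  exists U' M', [/\ layered U' M', reduced (dset U' M'), #|M'| = #|M|
    & bottoms T \subset U' :|: M'].
Proof.
elim/card_set_ind: U M => U IH M lay aUM botUM.
have [red|nred] := pselect (reduced (dset U M)); first by exists U, M.
have card_ex x m : m \in M -> x \notin M -> #|x |: M :\ m| = #|M|.
  move=> mM xM; rewrite cardsU1 in_setD1 (negPf xM) andbF /=.
  by rewrite [in RHS](cardsD1 m) mM.
have nsq p q : ~ sq (dset U M) p q by apply: alive_sq.
have [p [t [q b]]] : exists p t q : rdouble T, br (dset U M) p t q.
  by apply: contrapT => h; apply: nred; split=> // p t q b; apply: h;
    exists p, t, q.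
have botD (V N : {set T}) : (forall z, z \in bottoms T -> z \in U :|: M ->
  z \in V :|: N) ->
    bottoms T \subset V :|: N.
  by move=> h; apply/subsetP => z zB; apply: h => //; apply: (subsetP botUM).
case: (dbr lay b) => [[x [t' [y b']]] | [x [m [[xU mM] xm cmx lmx um]]]].
  case: (b') => [] [xA tA yA] [xt ty] lxy [ltx ctx] _.
  have cxt : rconc x t' by rewrite rconcC.
  have tB := not_bottom cxt xt.
  have yB := not_bottom (rconc_eqlab lxy) (ltn_trans xt ty).
  move: yA; rewrite in_setU => /orP[yU|yM].
    have [a' lay'] := dset_reflect lay b' yU aUM.
    apply: (IH _ _ M lay' a').
      apply: proper_card; apply/properP; split.
        by apply/subsetP => z; rewrite mem_D2 => /and3P[].
      by exists y; rewrite // !inE eqxx.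
    apply: botD => z zB; rewrite !in_setU !in_setD1.
    have -> : z != y by apply: contraNneq yB => <-.
    by have -> : z != t' by apply: contraNneq tB => <-.
  have [a' lay'] := dset_absorb lay b' yM aUM.
  have xU : x \in U.
    have [_ /(_ x xA (rconc_eqlab lxy))] := lay y yM.
    by case=> // e; rewrite e in xt; rklia.
  have xM : x \notin M by apply/negP => /lay[]; rewrite xU.
  rewrite -(card_ex x y yM xM); apply: (IH _ _ _ lay' a').
    apply: proper_card; apply/properP; split.
      by apply/subsetP => z; rewrite mem_D2 => /and3P[].
    by exists x; rewrite // !inE eqxx.
  apply: botD => z zB; rewrite !(in_setU, in_set1, in_setD1).
  have -> : z != y by apply: contraNneq yB => <-.
  have -> : z != t' by apply: contraNneq tB => <-.
  by case: eqVneq => //=; rewrite orbT.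
have [a' lay'] := dset_exchange lay xU mM xm cmx lmx um aUM.
have xM : x \notin M by apply/negP => /lay[]; rewrite xU.
rewrite -(card_ex x m mM xM); apply: (IH _ _ _ lay' a').
  by rewrite [X in _ < X](cardsD1 x) xU.
apply: botD => z zB; rewrite !(in_setU, in_set1, in_setD1).
have -> : z != m.
  by apply: contraTneq zB => ->; apply: (not_bottom _ xm); rewrite rconcC.
by case: eqVneq => //=; rewrite orbT.
Qed.

Lemma ex_max_rk U : U != set0 -> exists2 x, x \in U & forall z, z \in U ->
  rk z <= rk x.
Proof.
by case/set0Pn=> x0 x0U;
  case: (@arg_maxnP _ x0 (mem U) (@rk _ _ T) x0U) => x xU h; exists x.
Qed.

Hypothesis deletion_alive : forall (S : rheap C) (A : {set S}) (a : S),
  reduced A -> a \in A -> alive (A :\ a).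

(** Deleting [m] from the middle leaves an alive heap by [deletion_alive], and normalising it costs
    nothing more in the middle layer. *)
Lemma dset_step U M m : layered U M -> reduced (dset U M) ->
    bottoms T \subset U :|: M -> m \in M -> m \notin bottoms T ->
  exists U' M', [/\ layered U' M', reduced (dset U' M'), #|M'| = #|M|.-1
    & bottoms T \subset U' :|: M'].
Proof.
move=> lay red botUM mM mB; have [mU _] := lay m mM.
have eA : dset U (M :\ m) = dset U M :\ inl m.
  apply/setP => -[] z; rewrite !in_setD1 ?dset_l ?dset_r ?in_setU ?in_setD1 //.
  rewrite (inj_eq (@inl_inj _ _)); have [->|//] := eqVneq z m.
  by rewrite (negPf mU).
have lay' : layered U (M :\ m).
  move=> m' /setD1P[m'm m'M]; have [m'U lm'] := lay m' m'M; split=> // z zA.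
  apply: lm'; move: zA; rewrite !in_setU in_setD1.
  by case/orP=> [->//|/andP[_ ->]]; rewrite orbT.
have [||U' [M' [l' r' c' b']]] := dset_normalize lay'.
- rewrite eA; apply: deletion_alive => //.
  by rewrite dset_l in_setU mM orbT.
- apply/subsetP => z zB; have := subsetP botUM z zB.
  rewrite !in_setU in_setD1; have -> // : z != m.
  by apply: contraNneq mB => <-.
by exists U', M'; split=> //; rewrite c' (cardsD1 m M) mM.
Qed.

(** Iterating [dset_step] leaves only minimal elements in the middle. Then [U] is empty: an element
    of [U] of largest rank would have nothing concurrent above it and would form a square with its
    mirror image. *)
Lemma dset_count U M : layered U M -> reduced (dset U M) ->
  bottoms T \subset U :|: M -> #|bottoms T| <= #|M|.
Proof.
have [n] := ubnP #|M|; elim: n U M => // n IH U M /ltnSE-Mn lay red botUM.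
have [MB|] := boolP (M \subset bottoms T); last first.
  case/subsetPn=> m mM mB.
  have [U' [M' [l' r' c' b']]] := dset_step lay red botUM mM mB.
  have M0 : 0 < #|M| by apply/card_gt0P; exists m.
  by apply: leq_trans (IH U' M' _ l' r' b') _; rewrite c'; lia.
suff U0 : U = set0 by apply: subset_leq_card; rewrite U0 set0U in botUM.
apply/eqP; apply: contraT => /ex_max_rk[x xU xmax].
case: red => nsq _; case: (nsq (inl x) (inr x)).
apply: dsq_lr => // z; rewrite in_setU => /orP[/xmax//|zM] czx.
rewrite leqNgt; apply/negP => xz; have := subsetP MB z zM.
by apply/negP; apply: (not_bottom _ xz); rewrite rconcC.
Qed.

(** Without predecessors, the heap doubled along its maximal elements is reduced, by [dsq] and
    [dbr]. A non-maximal element of largest rank has a maximal one above it; the latter is not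
    minimal, and a first [dset_step] at it makes the inequality strict. *)
Lemma bottoms_lt_tops : reduced [set: T] -> (forall a b, ~ rprec [set: T] a b) ->
  ~~ (tops T == [set: T]) -> #|bottoms T| < #|tops T|.
Proof.
move=> redT nprec ntop; pose U := ~: tops T;
  have UM : U :|: tops T = setT by rewrite setUC setUCr.
have lay : layered U (tops T).
  move=> m mM; rewrite inE mM; split=> // z _ czm nzm.
  have zm : rk z < rk m.
    have := topsP _ mM z czm; case: (rk_neq czm nzm) => //; rklia.
  split=> //; rewrite inE; apply/negP => /topsP/(_ m).
  by rewrite rconcC => /(_ czm); rklia.
have red : reduced (dset U (tops T)).
  case: redT => nsq nbr; split=> [p q s | p t q b].
    case: (dsq lay s); rewrite UM; first by case=> x [y /nsq].
    case=> x; rewrite inE => /negP xN h; apply: xN; apply/topsP => z.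
    by apply: h; rewrite inE.
  case: (dbr lay b); rewrite UM; first by case=> x [t' [y /nbr]].
  case=> x [m [[xU mM] xm cmx lmx um]]; apply: (nprec m x); split=> //.
  - by move=> z _; apply: (topsP _ mM).
  - by split; [rewrite rconcC | exact: nesym].
have [x xU xmax] : exists2 x, x \in U & forall z, z \in U -> rk z <= rk x.
  by apply: ex_max_rk; apply: contra ntop => /eqP U0; rewrite -UM U0 set0U.
have [m cmx xm] : exists2 z, rconc z x & rk x < rk z.
  by apply: topsN; move: xU; rewrite inE.
have mM : m \in tops T.
  by apply: contraT => mN; have := xmax m; rewrite inE mN => /(_ isT); rklia.
have mB : m \notin bottoms T by apply: (not_bottom _ xm); rewrite rconcC.
have botUM : bottoms T \subset U :|: tops T by rewrite UM subsetT.
have [U' [M' [l' r' c' b']]] := dset_step lay red botUM mM mB.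
have M0 : 0 < #|tops T| by apply/card_gt0P; exists m.
by have := dset_count l' r' b'; rewrite c'; lia.
Qed.

End Peeling.

(** If no predecessor existed in either direction, the count on [T] and the count on its reverse
    would give opposite strict inequalities. *)
Lemma exists_rprec (P : choiceType) (C : concurrency P) (T : rheap C) :
  (forall (S : rheap C) (A : {set S}) (a : S),
     reduced A -> a \in A -> alive (A :\ a)) ->
  reduced [set: T] -> ~~ (tops T == [set: T]) ->
  exists a b, rprec [set: T] a b \/ rprec (T := rrev T) [set: T] a b.
Proof.
move=> del redT ntop; apply: contrapT => nex.
have topsE : tops (rrev T) = bottoms T.
  apply/setP => a; apply/idP/idP.
    move/topsP => h; apply/(@bottomsP _ _ T) => z /h.
    by rewrite rev_rk_leE.
  move/(@bottomsP _ _ T) => h; apply/topsP => z /h.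
  by rewrite rev_rk_leE.
have botsE : bottoms (rrev T) = tops T.
  apply/setP => a; apply/idP/idP.
    move/bottomsP => h; apply/(@topsP _ _ T) => z /h.
    by rewrite rev_rk_leE.
  move/(@topsP _ _ T) => h; apply/bottomsP => z /h.
  by rewrite rev_rk_leE.
have h1 : #|bottoms T| < #|tops T|.
  by apply: bottoms_lt_tops => // a b ab; apply: nex; exists a, b; left.
have h2 : #|bottoms (rrev T)| < #|tops (rrev T)|.
  apply: bottoms_lt_tops => //; first exact/reduced_rev.
    by move=> a b ab; apply: nex; exists a, b; right.
  rewrite topsE; apply: contra ntop => /eqP bT; apply/eqP/setP => a.
  rewrite [RHS]inE; apply/topsP => z _.
  by move: h1; rewrite bT cardsT ltnNge max_card.
by move: h2; rewrite topsE botsE ltnNge (ltnW h1).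
Qed.

(** * Acyclicity in terms of jumps *)

Section Acyclicity.

Import GRing.Theory.
Local Open Scope ring_scope.

Variables (P : choiceType) (C : concurrency P) (k : fieldType).

Section OneHeap.

Variable T : rheap C.
Implicit Types (A : {set T}) (a b v w x y t : T) (al : T -> k).

(** The jumps at these [w] add up to the coefficient of [v] in the boundary: each other label
    concurrent with that of [v] contributes the value of the chain at time [v]. See
    [boundary_jump]. *)
Definition low w v := [&& (rk w < rk v)%N, rconc w v & rlab w != rlab v].

(* [al v] stands for the jump at [v] of a 1-chain, seen as a function of
   "time" on each label; the last two conditions say that the chain is a cycle
   and that it vanishes after the last element of each label. *)
Definition jump_cycle A al := [/\ forall w, w \notin A -> al w = 0,
  forall v, v \in A -> \sum_(w | low w v) al w = 0
  & forall Q : pred P, \sum_(w | Q (rlab w)) al w = 0].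

Definition racyclic A := forall al, jump_cycle A al -> forall v, al v = 0.

Lemma sum_dipole (Q : pred T) al c x y :
  \sum_(w | Q w) (al w + c * ((w == x)%:R - (w == y)%:R)) =
  \sum_(w | Q w) al w + c * ((Q x)%:R - (Q y)%:R).
Proof.
rewrite big_split /= -big_distrr /= sumrB.
suff sumE z : \sum_(w | Q w) ((w == z)%:R : k) = (Q z)%:R by rewrite !sumE.
rewrite big_mkcond (bigD1 z) //= eqxx big1 ?addr0; first by case: (Q z).
by move=> w /negPf->; rewrite if_same.
Qed.

(** The chain supported between [x] and [y], with jumps 1 at [x] and -1 at [y], is a cycle because
    nothing concurrent lies between them. *)
Lemma racyclic_sq A x y : sq A x y -> ~ racyclic A.
Proof.
case=> xA yA lxy xy bxy acA.
pose al w : k := 0 + 1 * ((w == x)%:R - (w == y)%:R).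
have nxy : x != y by apply/eqP => e; rewrite e ltnn in xy.
suff /acA/(_ x)/eqP : jump_cycle A al.
  by rewrite /al eqxx (negPf nxy) subr0 mulr1 add0r oner_eq0.
split; rewrite /al.
- move=> w wA; have -> : w == x = false by apply: contraNF wA => /eqP->.
  by have -> : w == y = false by [apply: contraNF wA => /eqP->];
    rewrite subr0 mulr0 addr0.
- move=> v vA; rewrite sum_dipole big1 // add0r mul1r.
  suff -> : low x v = low y v by rewrite subrr.
  rewrite /low -lxy -(rconc_labl _ lxy); case cxv: (rconc x v) => //=;
    last by rewrite !andbF.
  have [_|lxv] := eqVneq (rlab x) (rlab v); first by rewrite !andbF.
  rewrite !andbT; apply/idP/idP => h1; last by rklia.
  have nyv : y <> v by move=> e; rewrite lxy e eqxx in lxv.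
  have cyv : rconc y v by rewrite -(rconc_labl _ lxy).
  case: (rk_neq cyv nyv) => // h2; have := bxy v vA h1 h2.
  by rewrite rconcC cxv.
- by move=> Q; rewrite sum_dipole big1 // lxy subrr mulr0 addr0.
Qed.

Section Braid.

Variables (A : {set T}) (x t y : T).
Hypothesis b : br A x t y.

Let xA : x \in A. Proof. by case: b => [] []. Qed.
Let tA : t \in A. Proof. by case: b => [] []. Qed.
Let yA : y \in A. Proof. by case: b => [] []. Qed.
Let lxy : rlab x = rlab y. Proof. by case: b. Qed.

Lemma low_braid v : v \in A :\ t :\ y -> low x v = low y v.
Proof.
case: b => _ [xt ty] _ [ltx ctx] bxy; rewrite mem_D2 => /and3P[/eqP vy /eqP vt vA].
rewrite /low -lxy -(rconc_labl _ lxy); case cxv: (rconc x v) => //=;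
  last by rewrite !andbF.
have [_|lxv] := eqVneq (rlab x) (rlab v); first by rewrite !andbF.
rewrite !andbT; apply/idP/idP => h1; last by rklia.
have cyv : rconc y v by rewrite -(rconc_labl _ lxy).
case: (rk_neq cyv (nesym vy)) => // h2; case: vt; apply: bxy => //.
by rewrite rconcC.
Qed.

Lemma low_braidl w : w \in A -> w != t -> low w x = low w y.
Proof.
case: b => _ [xt ty] _ [ltx ctx] bxy wA /eqP wt.
rewrite /low -lxy -(rconc_lab _ lxy); case cwx: (rconc w x) => //=;
  last by rewrite !andbF.
have [_|lwx] := eqVneq (rlab w) (rlab x); first by rewrite !andbF.
rewrite !andbT; apply/idP/idP => h1; first by rklia.
have nwx : w <> x by move=> e; rewrite e eqxx in lwx.
by case: (rk_neq cwx nwx) => // h2; case: wt; apply: bxy.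
Qed.

Lemma low_xt : low x t.
Proof.
case: b => _ [xt ty] _ [ltx ctx] _; rewrite /low xt rconcC ctx /=.
by apply/eqP; apply: nesym.
Qed.

Lemma low_yt : low y t = false.
Proof. by case: b => _ [xt ty] _ _ _; rewrite /low ltnNge ltnW. Qed.

Lemma low_ty : low t y.
Proof.
case: b => _ [xt ty] _ [ltx ctx] _; rewrite /low ty -(rconc_lab _ lxy) ctx /=.
by rewrite -lxy; apply/eqP.
Qed.

Lemma low_tx : low t x = false.
Proof. by case: b => _ [xt ty] _ _ _; rewrite /low ltnNge ltnW. Qed.

(** Between [x] and [y] only [t] can contribute. Hence the cycle conditions at [x] and at [y]
    together force [al t = 0]. *)
Lemma sum_low_xy al : (forall w, w \notin A -> al w = 0) ->
  \sum_(w | low w y) al w = al t + \sum_(w | low w x) al w.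
Proof.
move=> supp; rewrite (bigD1 t low_ty) /=; congr (_ + _).
rewrite [RHS]big_mkcond [LHS]big_mkcond /=; apply: eq_bigr => w _.
have [wA|/supp->] := boolP (w \in A); last by rewrite !if_same.
have [->|wt] := eqVneq w t; first by rewrite andbF low_tx.
by rewrite andbT low_braidl.
Qed.

(** Among the remaining conditions only the one at [t] distinguishes a jump at [x] from a jump at
    [y]. Cycles are therefore carried from one heap to the other by shifting a jump between [x] and
    [y]. *)
Lemma racyclic_br : racyclic A <-> racyclic (A :\ t :\ y).
Proof.
have ynt := br_neq b; have nyx : y != x.
  by case: b => _ [xt ty] _ _ _; apply/eqP => e; rewrite e in ty; rklia.
have nlab z w : rlab z = rlab w -> low z w = false by rewrite /low => ->;
  rewrite eqxx !andbF.
split=> ac al [supp cyc tot].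
  have al_t : al t = 0 by apply: supp; rewrite !inE eqxx andbF.
  have al_y : al y = 0 by apply: supp; rewrite !inE eqxx.
  have suppA w : w \notin A -> al w = 0.
    by move=> wA; apply: supp; rewrite mem_D2 (negPf wA) !andbF.
  (* The defect at [t], the one condition that a cycle of the shortened heap may violate; a dipole
     of strength [c] on [x] and [y] repairs it. *)
  pose c := \sum_(w | low w t) al w.
  have h := ac (fun w => al w + c * ((w == y)%:R - (w == x)%:R)).
  have /h al'0 : jump_cycle A (fun w => al w + c * ((w == y)%:R - (w == x)%:R)).
    split.
    - move=> w wA; rewrite suppA // add0r.
      have -> : w == x = false by apply: contraNF wA => /eqP->.
      by have -> : w == y = false by [apply: contraNF wA => /eqP->];
        rewrite subrr mulr0.
    - move=> v vA; rewrite sum_dipole; have [vB|] := boolP (v \in A :\ t :\ y).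
        by rewrite cyc // low_braid // subrr mulr0 addr0.
      rewrite mem_D2 vA andbT negb_and !negbK => /orP[/eqP->|/eqP->].
        rewrite sum_low_xy // al_t cyc; last first.
          rewrite mem_D2 eq_sym nyx xA andbT; apply/eqP => e.
          by have := low_xt; rewrite e nlab.
        by rewrite !nlab // subrr mulr0 !addr0.
      by rewrite low_xt low_yt -/c sub0r mulrN1 subrr.
    - by move=> Q; rewrite sum_dipole tot lxy subrr mulr0 addr0.
  have c0 : c = 0 by have := al'0 y;
    rewrite eqxx (negPf nyx) subr0 mulr1 al_y add0r.
  by move=> v; have := al'0 v; rewrite c0 mul0r addr0.
have al_t : al t = 0.
  by have := cyc y yA; rewrite sum_low_xy // cyc // addr0.
(* The jump at [y] is moved to [x], which gives a cycle supported off [t] and [y]. *)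
have h := ac (fun w => al w + al y * ((w == x)%:R - (w == y)%:R)).
have /h be0 : jump_cycle (A :\ t :\ y) (fun w =>
  al w + al y * ((w == x)%:R - (w == y)%:R)).
  split.
  - move=> w; rewrite mem_D2 !negb_and !negbK => /or3P[/eqP->|/eqP->|wA].
    + by rewrite eqxx (negPf nyx) sub0r mulrN1 subrr.
    + have -> : t == x = false by apply/negP => /eqP e; have := low_xt;
      rewrite e nlab.
      by rewrite (negPf ynt) subrr mulr0 addr0.
    + rewrite supp // add0r;
      have -> : w == x = false by apply: contraNF wA => /eqP->.
      by have -> : w == y = false by [apply: contraNF wA => /eqP->];
        rewrite subrr mulr0.
  - move=> v vB; rewrite sum_dipole low_braid // subrr mulr0 addr0 cyc //.
    by move: vB; rewrite mem_D2 => /and3P[].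
  - by move=> Q; rewrite sum_dipole tot lxy subrr mulr0 addr0.
have alE w : al w = 0 + al y * ((w == y)%:R - (w == x)%:R).
  by rewrite add0r; apply/eqP; rewrite -subr_eq0 -mulrN opprB; apply/eqP/be0.
have al_y : al y = 0.
  have := cyc t tA; rewrite (eq_bigr _ (fun w _ => alE w)) sum_dipole big1 // add0r.
  by rewrite low_xt low_yt sub0r mulrN1 => /eqP; rewrite oppr_eq0 => /eqP.
by move=> v; rewrite alE al_y mul0r addr0.
Qed.

End Braid.

Lemma racyclic_alive A : racyclic A -> alive A.
Proof.
elim/card_set_ind: A => A IH ac; apply: alive_intro => [x y s|x t y b].
  by apply: racyclic_sq s ac.
apply: IH; last exact/(racyclic_br b).
apply: proper_card; apply/properP; case: (b) => [] [_ tA _] _ _ _ _.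
split; last by exists t; rewrite // mem_D2 eqxx andbF.
by apply/subsetP => z; rewrite mem_D2 => /and3P[].
Qed.

(** The jumps over the labels other than that of [b] and concurrent with it have total zero. Of
    their elements in [A], all but [a] lie below [b], and these sum to zero by the condition at [b].
    So [al a = 0], and the cycle lives on [A :\ a]. *)
Lemma racyclic_prec A a b : rprec A a b -> racyclic (A :\ a) -> racyclic A.
Proof.
case=> [[aA bA] ta ba [cba lba] ub] ac al [supp cyc tot].
have al_a : al a = 0.
  have := tot (fun l => C l (rlab b) && (l != rlab b)).
  rewrite (bigD1 a) /=; last first.
    by rewrite -/(rconc a b) rconcC cba /= eq_sym; apply/eqP.
  rewrite -[RHS](cyc b bA) -{1}[al a]subr0 => /eqP; rewrite eq_sym -subr_eq0.
  rewrite subr0 opprD addrCA (_ :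
    \sum_(w | low w b) _ = \sum_(i | [&& C (rlab i) (rlab b),
      rlab i != rlab b & i != a]) al i).
    by rewrite (eq_bigl (fun i =>
      [&& C (rlab i) (rlab b), rlab i != rlab b & i != a])) => [|i];
        rewrite ?andbA // subrr addr0 oppr_eq0 => /eqP.
  rewrite [RHS]big_mkcond [LHS]big_mkcond /=; apply: eq_bigr => w _.
  have [wA|/supp->] := boolP (w \in A); last by rewrite !if_same.
  rewrite /low /rconc; case cwb: (C _ _); rewrite ?andbF //=.
  have [_|lwb] := eqVneq (rlab w) (rlab b); rewrite ?andbF //= andbT.
  have [->|wa] := eqVneq w a; first by rewrite ltnNge ltnW.
  have nwb : w <> b by move=> e; rewrite e eqxx in lwb.
  case: (rk_neq cwb nwb) => [->//|h].
  by rewrite (ub w wA cwb h) eqxx in wa.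
apply: ac; split=> //.
- by move=> w; rewrite in_setD1 negb_and negbK => /orP[/eqP->|/supp].
- by move=> v /setD1P[_]; apply: cyc.
Qed.

End OneHeap.

(** Jumps total zero over every set of labels, so the sum below [v] is minus the sum above [v]. *)
Lemma racyclic_rev (T : rheap C) (A : {set T}) :
  racyclic A <-> racyclic (A : {set rrev T}).
Proof.
have key (al : T -> k) v : (forall Q : pred P, \sum_(w | Q (rlab w)) al w = 0) ->
    \sum_(w : T | low w v) al w = - \sum_(w : T | low (w : rrev T) v) al w.
  move=> tot; apply/eqP; rewrite -addr_eq0.
  have := tot (fun l => C l (rlab v) && (l != rlab v)).
  rewrite (bigID (fun w => (rk w < rk v)%N)) /= => /eqP.
  congr (_ + _ == _); apply: eq_bigl => w.
    by rewrite /low andbC.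
  rewrite /low rev_rkE /rconc /=; case cwv: (C _ _) => //=; last by rewrite andbF.
  have [_|lwv] := eqVneq (rlab w) (rlab v); rewrite ?andbF //= andbT.
  have nwv : w <> v by move=> e; rewrite e eqxx in lwv.
  by case: (rk_neq cwv nwv) => h; rklia.
split=> ac al [supp cyc tot]; apply: ac; split=> // v vA.
  by rewrite key // cyc // oppr0.
by apply/eqP; rewrite -oppr_eq0 -key // cyc.
Qed.

Lemma racyclic_imset (T T' : rheap C) (f : T -> T') (A : {set T}) :
  rembed f A -> racyclic (f @: A) <-> racyclic A.
Proof.
move=> fA; have [fi fl fr] := fA.
have lowE : {in A &, forall w v, low (f w) (f v) = low w v}.
  move=> w v wA vA; rewrite /low !fl // (rembed_conc fA) //.
  by case cwv: (rconc w v); rewrite ?andbF // fr.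
split=> ac al [supp cyc tot].
  pose al' z := \sum_(w | (w \in A) && (f w == z)) al w.
  have sumE (Q' : pred T') (Q : pred T) : {in A, forall w, Q' (f w) = Q w} ->
      \sum_(z | Q' z) al' z = \sum_(w | Q w) al w.
    move=> QE; transitivity (\sum_(w | (w \in A) && Q' (f w)) al w).
      rewrite (partition_big f Q') /=; last by move=> w /andP[].
      apply: eq_bigr => z Qz; apply: eq_bigl => w.
      by case: eqP => [->|]; rewrite ?Qz ?andbT ?andbF.
    rewrite big_mkcond [RHS]big_mkcond; apply: eq_bigr => w _ /=.
    by have [wA|/supp->] := boolP (w \in A); rewrite ?if_same //= QE.
  have : jump_cycle (f @: A) al'.
    split.
    - move=> z zA; rewrite /al' big_pred0 // => w; apply/negP => /andP[wA /eqP e].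
      by case/negP: zA; rewrite -e imset_f.
    - move=> _ /imsetP[v vA ->]; rewrite (sumE _ (fun w => low w v)) ?cyc //.
      by move=> w wA; rewrite lowE.
    - by move=> Q; rewrite (sumE _ (fun w => Q (rlab w))) ?tot // => w wA;
      rewrite fl.
  move/ac => al'0 v; have [vA|/supp//] := boolP (v \in A).
  rewrite -[RHS](al'0 (f v)) /al' (big_pred1 v) // => w.
  apply/andP/eqP => [[wA /eqP/fi->]//|->]; by rewrite vA eqxx.
pose al' w := if w \in A then al (f w) else 0.
have sumE (Q : pred T) (Q' : pred T') : {in A, forall w, Q' (f w) = Q w} ->
    \sum_(w | Q w) al' w = \sum_(z | Q' z) al z.
  move=> QE; rewrite [RHS]big_mkcond [RHS](bigID (mem (f @: A))) /=.
  rewrite [X in _ + X]big1 ?addr0 => [|z /supp->]; last by rewrite if_same.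
  rewrite big_imset //= [LHS]big_mkcond [RHS]big_mkcond; apply: eq_bigr => w _ /=.
  by rewrite /al'; have [wA|wA] := boolP (w \in A); rewrite ?if_same // QE.
have /ac al'0 : jump_cycle A al'.
  split.
  - by move=> w wA; rewrite /al' (negPf wA).
  - move=> v vA; rewrite (sumE _ (fun z => low z (f v))) ?cyc ?imset_f //.
    by move=> w wA; rewrite lowE.
  - by move=> Q; rewrite (sumE _ (fun z => Q (rlab z))) ?tot // => w wA; rewrite fl.
move=> z; have [/imsetP[w wA ->]|/supp//] := boolP (z \in f @: A).
by have := al'0 w; rewrite /al' wA.
Qed.

Definition rstrong (T : rheap C) (A : {set T}) :=
  racyclic A /\ forall v, v \in A -> racyclic (A :\ v).

(** Removing [a] makes [b] maximal, so [T] minus [a] and [T] minus [a] and [b] are both reduced and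
    covered by the hypothesis. Only the deletion of [b] alone needs a separate argument. *)
Lemma rstrong_prec (T : rheap C) (a b : T) :
    (forall A : {set T}, A != setT -> reduced A -> rstrong A) ->
  reduced [set: T] -> rprec [set: T] a b -> rstrong [set: T].
Proof.
move=> IH redT prec; have [_ ta ba [cba lba] ub] := prec.
have precS (A : {set T}) : a \in A -> b \in A -> rprec A a b.
  by move=> aA bA; split=> // z _; [apply: ta | apply: ub].
have nT (v : T) (A : {set T}) : v \notin A -> A != setT by apply: contraNneq => ->.
have nab : b != a by apply/eqP => e; rewrite e ltnn in ba.
have redTa := reduced_top redT ta.
have tb : rtop (setT :\ a) b.
  move=> z /setD1P[za _] czb; rewrite leqNgt; apply/negP => bz.
  by rewrite (ub z (in_setT z) czb bz) eqxx in za.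
have redTab := reduced_top redTa tb.
have aTa : a \notin [set: T] :\ a by rewrite in_setD1 eqxx.
have aTab : a \notin [set: T] :\ a :\ b by rewrite mem_D2 eqxx andbF.
have bTb : b \notin [set: T] :\ b by rewrite in_setD1 eqxx.
have [acTa acTav] := IH _ (nT a _ aTa) redTa.
have [_ acTabv] := IH _ (nT a _ aTab) redTab.
split; first by apply: racyclic_prec prec acTa.
move=> v _; have [->//|va] := eqVneq v a.
have [->|vb] := eqVneq v b; last first.
  apply: (@racyclic_prec _ _ a b).
    by apply: precS; rewrite !inE eq_sym ?va ?vb.
  rewrite setDDl setUC -setDDl; apply: acTav.
  by rewrite !inE va.
have memb z : z \in [set: T] :\ b = (z != b) by rewrite !inE andbT.
have [nsq nbr] := redT.
have last_a y : rconc y b -> (rk b < rk y)%N -> y = a by apply: ub; rewrite inE.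
have [redb|nred] := pselect (reduced ([set: T] :\ b)).
  by have [] := IH _ (nT b _ bTb) redb.
(* A new square must have been separated by [b]. Its upper end is then [a], the only concurrent
   element above [b], and [x], [b], [a] would be a braid chain of [T]. *)
have nsqb x y : ~ sq ([set: T] :\ b) x y.
  case=> xA yA lxy xy bxy.
  have [/andP[/andP[xb rby] cbx]|nb] := boolP ((rk x < rk b < rk y)%N && rconc b x).
    have ya : y = a by apply: last_a => //; rewrite -(rconc_labl _ lxy) rconcC.
    apply: (nbr x b y); split; rewrite ?inE //; first by rewrite lxy ya.
    move=> z _ h1 h2 czx; have [//|zb] := eqVneq z b.
    by have := bxy z; rewrite memb zb czx h1 h2 => /(_ isT isT isT).
  apply: (nsq x y); split; rewrite ?inE // => z _ h1 h2.
  have [ez|zb] := eqVneq z b; last by apply: bxy; rewrite ?memb.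
  by move: nb; rewrite -ez h1 h2.
have [x [t [y b']]] : exists x t y, br ([set: T] :\ b) x t y.
  by apply: contrapT => h; apply: nred; split=> // x t y b'; apply: h;
    exists x, t, y.
(* A new braid chain likewise ends at [a]. Its move deletes [t] and [a], leaving [T] minus [a], [b]
   and [t], a one-element deletion of a reduced heap. *)
apply/(racyclic_br b'); case: b' => [] [xA tA yA] xty lxy ltx bxy.
have [/andP[/andP[xb rby] cbx]|nb] :=
  boolP ((rk x < rk b < rk y)%N && rconc b x); last first.
  case: (nbr x t y); split; rewrite ?inE // => z _ h1 h2 czx.
  have [ez|zb] := eqVneq z b; last by apply: bxy; rewrite ?memb.
  by move: nb; rewrite -ez h1 h2 czx.
have ya : y = a by apply: last_a => //; rewrite -(rconc_labl _ lxy) rconcC.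
have -> : [set: T] :\ b :\ t :\ y = [set: T] :\ a :\ b :\ t.
  by rewrite ya; apply/setP => z; rewrite !inE; case: (z == a); case: (z == b);
    case: (z == t).
apply: acTabv; rewrite mem_D2 inE andbT -memb tA /=.
by apply/eqP => e; move: xty; rewrite ya -e ltnn => -[].
Qed.

(** When all elements are maximal, each label occurs at most once, and the vanishing of the total
    over a label is the vanishing of a single jump. *)
Lemma racyclic_tops (T : rheap C) (A : {set T}) :
  tops T = [set: T] -> racyclic A.
Proof.
move=> topT al [supp _ tot] v; rewrite -[RHS](tot (pred1 (rlab v))).
rewrite (big_pred1 v) // => w /=; apply/eqP/eqP => [|->//] e.
have cwv := rconc_eqlab e; apply: (rk_inj cwv).
have : v \in tops T by rewrite topT inE.
have : w \in tops T by rewrite topT inE.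
move=> /topsP/(_ v) + /topsP/(_ w cwv); rewrite rconcC => /(_ cwv).
by move=> h1 h2; apply/eqP; rewrite eqn_leq h1 h2.
Qed.

End Acyclicity.

(** * From heaps and subheaps to ranked heaps *)

Section HeapRank.

Variables (P : choiceType) (C : concurrency P).

Section OneHeap.

Variable E : heap C.
Implicit Types (a b x y z : E).

(** The key by which [hlinear] sorts, so that [heap_word] reads the labels by increasing rank. *)
Definition ideal_size a := #|[set x | hle x a]|.

Lemma hlt_ideal_size a b : hlt a b -> ideal_size a < ideal_size b.
Proof.
case/andP=> nab ab; apply/proper_card/properP; split.
  by apply/subsetP=> x; rewrite !inE => /hle_trans; apply.
exists b; rewrite !inE ?hle_refl //.
by apply: contra nab => ba; apply/eqP/hle_anti; rewrite ab ba.
Qed.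

Lemma ideal_size_inj a b :
  C (label a) (label b) -> ideal_size a = ideal_size b -> a = b.
Proof.
move=> cab e; apply: contrapT => /eqP nab.
case/orP: (hle_conc cab) => h.
  by have := @hlt_ideal_size a b; rewrite /hlt /= nab h e ltnn => /(_ isT).
by have := @hlt_ideal_size b a; rewrite /hlt /= eq_sym nab h e ltnn => /(_ isT).
Qed.

Definition of_heap : rheap C := RHeap ideal_size_inj.

Lemma hlt_rk a b : hlt a b -> rk (a : of_heap) < rk (b : of_heap).
Proof. exact: hlt_ideal_size. Qed.

Lemma rk_hlt a b : rconc (a : of_heap) b ->
  (rk (a : of_heap) < rk (b : of_heap)) = hlt a b.
Proof.
move=> cab; apply/idP/idP => [ab|]; last exact: hlt_rk.
have nab : a != b by apply: contraTneq ab => ->; rewrite ltnn.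
case/orP: (hle_conc cab) => h; first by rewrite /hlt /= nab h.
by have := @hlt_rk b a; rewrite /hlt /= eq_sym nab h ltnNge (ltnW ab) => /(_ isT).
Qed.

Lemma hltW a b : hlt a b -> hle a b.
Proof. by case/andP. Qed.

Lemma hle_lt_trans a b c : hle a b -> hlt b c -> hlt a c.
Proof.
move=> ab /andP[nbc bc]; rewrite /hlt /= (hle_trans ab bc) andbT.
by apply: contraNneq nbc => e; apply/eqP/hle_anti; rewrite bc -e ab.
Qed.

Lemma hlt_le_trans a b c : hlt a b -> hle b c -> hlt a c.
Proof.
move=> /andP[nab ab] bc; rewrite /hlt /= (hle_trans ab bc) andbT.
by apply: contraNneq nab => e; apply/eqP/hle_anti; rewrite ab e bc.
Qed.

Lemma hlt_trans a b c : hlt a b -> hlt b c -> hlt a c.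
Proof. by move=> /hltW ab; apply: hle_lt_trans. Qed.

Lemma hlt_irr a : hlt a a = false.
Proof. by rewrite /hlt /= eqxx. Qed.

(** The order is generated by concurrent pairs. Together with [hlt_last], this allows convexity to
    be tested on concurrent elements only. *)
Lemma hlt_first a b : hlt a b ->
  exists z, [/\ hlt a z, C (label a) (label z) & hle z b].
Proof.
case/andP=> nab; rewrite hle_gen => /connectP[p + e].
elim: p a nab e => [|c p IH] a nab /=; first by move=> e; rewrite e eqxx in nab.
move=> e /andP[/andP[ac cac] cp].
have cb : hle c b.
  by rewrite hle_gen; apply/connectP; exists p.
have [eac|nac] := eqVneq a c; last by exists c; rewrite /hlt /= nac.
by subst c; apply: IH.
Qed.

Lemma hlt_last a b : hlt a b ->
  exists z, [/\ hle a z, C (label z) (label b) & hlt z b].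
Proof.
case/andP=> nab; rewrite hle_gen => /connectP[p].
elim/last_ind: p b nab => [|p c IH] b nab /=; first by move=> _ e;
  rewrite e eqxx in nab.
rewrite rcons_path last_rcons => /andP[ap /andP[lc clc]] e; subst b.
have al : hle a (last a p) by rewrite hle_gen; apply/connectP; exists p.
have [elc|nlc] := eqVneq (last a p) c; last by exists (last a p);
  rewrite /hlt /= nlc.
by apply: IH.
Qed.

Lemma propP2_reduced : propP2 E <-> reduced [set: of_heap].
Proof.
split=> [p2 | [nsq nbr] s [ss conv] bal].
  split=> [x y [_ _ lxy rxy bxy] | x t y [_ [xt ty] lxy [ltx ctx] bxy]].
    have xy : hlt (x : E) y by rewrite -rk_hlt // rconc_eqlab.
    have cv : convex_chain [:: (x : E); y].
      split=> [|p z q]; first by rewrite /= xy.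
      have none : ~ (hlt (x : E) z /\ hlt (z : E) y).
        case=> xz zy; have [w [xw cxw wz]] := hlt_first xz.
        have := bxy w (in_setT w) (hlt_rk xw) (hlt_rk (hle_lt_trans wz zy)).
        by rewrite rconcC /rconc /= cxw.
      rewrite !inE => /orP[]/eqP-> /orP[]/eqP-> h1 h2.
      - by have := hlt_trans h1 h2; rewrite hlt_irr.
      - by case: none.
      - by have := hlt_trans (hlt_trans h1 h2) xy; rewrite hlt_irr.
      - by have := hlt_trans h1 h2; rewrite hlt_irr.
    by case: (p2 _ cv lxy).
  have hxt : hlt (x : E) t by rewrite -rk_hlt // rconcC.
  have hty : hlt (t : E) y by rewrite -rk_hlt // -(rconc_lab _ lxy).
  have cv : convex_chain [:: (x : E); t; y].
    split=> [|p z q]; first by rewrite /= hxt hty.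
    have all_in w : w \in [:: (x : E); t; y] -> hle x w /\ hle w y.
      rewrite !inE => /or3P[]/eqP->; split;
        rewrite ?hle_refl ?(hltW hxt) ?(hltW hty) //.
        exact: hltW (hlt_trans hxt hty).
      exact: hltW (hlt_trans hxt hty).
    move=> /all_in[xp _] /all_in[_ qy] pz zq.
    have xz := hle_lt_trans xp pz; have zy := hlt_le_trans zq qy.
    (* The first concurrent step from [x] towards [z] and the last one from [z] to [y] can only be
       [t], which squeezes [z] between [t] and itself. *)
    have [w [xw cxw wz]] := hlt_first xz.
    have [w' [zw' cw'y w'y]] := hlt_last zy.
    have ew : w = t.
      apply: bxy; rewrite ?inE //; first exact: hlt_rk.
        exact: hlt_rk (hle_lt_trans wz zy).
      by rewrite rconcC.
    have ew' : w' = t.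
      apply: bxy; rewrite ?inE //; first exact: hlt_rk (hlt_le_trans xz zw').
        exact: hlt_rk.
      by rewrite (rconc_lab (T := of_heap) _ lxy).
    have -> : z = t by apply: hle_anti; rewrite -{1}ew' zw' -ew wz.
    by rewrite !inE eqxx orbT.
  by case: (p2 _ cv lxy).
split=> sz.
  case: s ss conv bal sz => [|x [|y []]] //=; rewrite andbT => xy conv lxy _.
  apply: (nsq x y); split; rewrite ?inE ?hlt_rk // => z _ h1 h2; apply/negP => czx.
  have xz : hlt x z by rewrite -rk_hlt // rconcC.
  have zy : hlt z y by rewrite -rk_hlt // -(rconc_lab (T := of_heap) _ lxy).
  have := conv x z y; rewrite !inE !eqxx orbT xz zy => /(_ isT isT isT isT).
  by case/orP=> /eqP e; rewrite e ?hlt_irr in xz zy.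
case: s ss conv bal sz => [|x [|t [|y []]]] //=;
  rewrite andbT => /andP[xt ty] conv lxy _.
have conv' z : hlt x z -> hlt z y -> z = t.
  move=> xz zy; have := conv x z y;
    rewrite !inE !eqxx !orbT xz zy => /(_ isT isT isT isT).
  by case/or3P=> /eqP // e; rewrite e ?hlt_irr in xz zy.
(* A balanced convex chain with three equal labels contains a square and is not a braid chain. *)
have [lxt|/eqP lxt] := eqVneq (label x) (label t).
  apply: (nsq x t); split; rewrite ?inE ?hlt_rk // => z _ h1 h2; apply/negP => czx.
  have xz : hlt x z by rewrite -rk_hlt // rconcC.
  have zt : hlt z t by rewrite -rk_hlt // -(rconc_lab (T := of_heap) _ lxt).
  by have := zt; rewrite (conv' z xz (hlt_trans zt ty)) hlt_irr.
have [w [xw cxw wt]] := hlt_first xt.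
have ew := conv' w xw (hle_lt_trans wt ty); subst w.
apply: (nbr x t y); split; rewrite ?inE ?hlt_rk //.
- by split; [apply: nesym | rewrite rconcC].
- move=> z _ h1 h2 czx; apply: conv'.
    by rewrite -rk_hlt // rconcC.
  by rewrite -rk_hlt // -(rconc_lab (T := of_heap) _ lxy).
Qed.

Lemma hmaxP a : reflect (forall z, ~ hlt a z) (a \in hmax E).
Proof.
rewrite inE; apply: (iffP forallP) => [h z /andP[naz az] | h z].
  by have := h z; rewrite az eq_sym (negPf naz).
by apply/implyP => az; apply/eqP; apply: contrapT => /eqP nza; apply: (h z);
  rewrite /hlt /= eq_sym nza.
Qed.

Lemma hminP a : reflect (forall z, ~ hlt z a) (a \in hmin E).
Proof.
rewrite inE; apply: (iffP forallP) => [h z /andP[naz az] | h z].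
  by have := h z; rewrite az (negPf naz).
by apply/implyP => az; apply/eqP; apply: contrapT => /eqP nza; apply: (h z);
  rewrite /hlt /= nza.
Qed.

End OneHeap.

Section Subheaps.

Variables (E : heap C) (F : {set E}).

Let sval (a : of_heap (subheap F)) : of_heap E := val a.

(** A subheap may lose order relations, but none between concurrent elements; hence it can be
    replaced by the subset [F] of [of_heap E]. *)
Lemma hlt_subheap (a b : subheap F) : C (label (val a)) (label (val b)) ->
  hlt a b = hlt (val a) (val b).
Proof.
move=> cab; rewrite /hlt /=; congr (_ && _); apply/idP/idP => [/subheap_sub//|ab].
by apply/connect1/andP.
Qed.

Lemma rembed_subheap (A : {set of_heap (subheap F)}) : rembed sval A.
Proof.
split=> [a b _ _ /val_inj// | // | a b _ _ cab].
by rewrite !rk_hlt // hlt_subheap.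
Qed.

Lemma imset_sval (A : {set E}) : A \subset F ->
  sval @: [set a | val a \in A] = A.
Proof.
move=> AF; apply/setP => z; apply/imsetP/idP => [[a]|zA];
  first by rewrite inE => aA ->.
by exists (Sub z (subsetP AF z zA)); rewrite ?inE.
Qed.

Lemma imset_svalT : sval @: setT = F.
Proof.
rewrite -[RHS](imset_sval (subxx F)).
suff -> : [set a : of_heap (subheap F) | val a \in F] = setT by [].
by apply/setP => a; rewrite !inE (valP a).
Qed.

Lemma propP2_subheap : propP2 (subheap F) <-> reduced (F : {set of_heap E}).
Proof.
have := reduced_imset (rembed_subheap setT).
by rewrite imset_svalT propP2_reduced => ->.
Qed.

Lemma racyclic_subheap k :
  racyclic k [set: of_heap (subheap F)] <-> racyclic k (F : {set of_heap E}).
Proof.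
by have := racyclic_imset k (rembed_subheap setT); rewrite imset_svalT => ->.
Qed.

Lemma racyclic_subheapD1 k (v : subheap F) :
  racyclic k ([set: of_heap (subheap F)] :\ v) <->
  racyclic k (F :\ val v : {set of_heap E}).
Proof.
have := racyclic_imset k (rembed_subheap (setT :\ v)).
by rewrite (imset_D1 (rembed_subheap _)) ?inE // imset_svalT => ->.
Qed.

End Subheaps.

End HeapRank.

(** * The boundary map and its translation into jumps *)

Section AcyclicHeap.

Import GRing.Theory.
Local Open Scope ring_scope.

Variables (P : choiceType) (C : concurrency P) (k : fieldType) (E : heap C).
Implicit Types (v w x y z : E) (e : edge E) (f : chain1 k E).

Local Notation T := (of_heap E).

Lemma edgeP e : [/\ hlt (val e).1 (val e).2, label (val e).1 = label (val e).2
  & forall z, label z = label (val e).1 -> hlt (val e).1 z -> hlt z (val e).2 ->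
    False].
Proof.
case/and3P: (valP e) => h1 /eqP h2 /existsP h3; split=> // z h4 h5 h6.
by apply: h3; exists z; rewrite h4 eqxx h5 h6.
Qed.

Lemma edge_eq1 e e' : (val e).1 = (val e').1 -> e = e'.
Proof.
move=> e1; have [h1 l1 u1] := edgeP e; have [h2 l2 u2] := edgeP e'.
apply: val_inj; case: (val e) (val e') e1 h1 l1 u1 h2 l2 u2 =>
  [x y] [x' y'] /= <- h1 l1 u1 h2 l2 u2.
congr pair; apply: contrapT => ny.
have lyy : label y = label y' by rewrite -l1.
have cyy : rconc (y : T) y' by apply: rconc_eqlab.
case: (rk_neq cyy ny) => h.
  by apply: (u2 y) => //; rewrite -rk_hlt.
by apply: (u1 y') => //; rewrite -rk_hlt // rconcC.
Qed.

Lemma edge_eq2 e e' : (val e).2 = (val e').2 -> e = e'.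
Proof.
move=> e2; apply: edge_eq1.
have [h1 l1 u1] := edgeP e; have [h2 l2 u2] := edgeP e'.
case: (val e) (val e') e2 h1 l1 u1 h2 l2 u2 =>
  [x y] [x' y'] /= <- h1 l1 u1 h2 l2 u2.
apply: contrapT => nx; have lxx : label x = label x' by rewrite l1.
have cxx : rconc (x : T) x' by apply: rconc_eqlab.
case: (rk_neq cxx nx) => h.
  by apply: (u1 x') => //; rewrite -rk_hlt.
by apply: (u2 x) => //; rewrite -rk_hlt // rconcC.
Qed.

Definition jump f w : k := \sum_e f e * ((w == (val e).1)%:R - (w == (val e).2)%:R).

Lemma sum_jump f (Q : pred E) :
  \sum_(w | Q w) jump f w = \sum_e f e * ((Q (val e).1)%:R - (Q (val e).2)%:R).
Proof.
rewrite exchange_big /=; apply: eq_bigr => e _.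
have := @sum_dipole _ _ k T Q (fun=> 0) (f e) (val e).1 (val e).2.
by rewrite big1_eq add0r => <-; apply: eq_bigr => w _; rewrite add0r.
Qed.

(** For an edge from [x] to [y], the difference of the indicators of [low x v] and [low y v] is 1
    exactly when [v] is concurrent with [x] and strictly between the ends, and 0 otherwise. *)
Lemma boundary_jump f v : boundary f v = \sum_(w : T | low w v) jump f w.
Proof.
rewrite sum_jump /boundary sum_ffunE; apply: eq_bigr => e _; rewrite ffunE /=.
congr (_ * _); have [] := edgeP e; case: e => -[x y] ed.
rewrite /edge_boundary /= => h1 l1 u1.
rewrite sum_ffunE; under eq_bigr do rewrite ffunE.
set Q := fun w => [&& hlt x w, hlt w y & C (label w) (label x)].
transitivity ((Q v)%:R : k).
  rewrite big_mkcond (bigD1 v) //= eqxx big1 ?addr0; last first.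
    by move=> w; rewrite eq_sym => /negPf->; rewrite if_same.
  by rewrite /Q; case: ifP.
rewrite /Q /low /rconc -[rlab (y : T)]/(label y) -l1 conc_sym.
case cxv: (C (label x) (label v)); rewrite ?andbF ?subr0 //= !andbT.
have [lxv|lxv] := eqVneq (label x) (label v); rewrite ?andbF ?andbT /=.
  case: andP => [[xv vy]|_]; last by rewrite subr0.
  by case: (u1 v).
rewrite !rk_hlt //; last by rewrite /rconc /= -l1.
have cyv : rconc (y : T) v by rewrite /rconc /= -l1.
have nyv : (y : T) <> v by move=> e'; rewrite l1 e' eqxx in lxv.
have xy := h1; case: (rk_neq cyv nyv) => h.
  have yv : hlt y v by rewrite -rk_hlt.
  rewrite yv (hlt_trans xy yv) subrr /=; case vy: (hlt v y) => //.
  by have := hlt_trans yv vy; rewrite hlt_irr.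
have vy : hlt v y by rewrite -rk_hlt // rconcC.
rewrite vy andbT; case yv: (hlt y v); rewrite ?subr0 //.
by have := hlt_trans yv vy; rewrite hlt_irr.
Qed.

(** Take an edge with nonzero coefficient and lowest start. An edge ending at that start begins
    lower, so its coefficient vanishes and the jump there is the coefficient itself. *)
Lemma jump_inj f : (forall w, jump f w = 0) -> f = 0.
Proof.
move=> jf; apply/ffunP => e; rewrite [RHS]ffunE; apply/eqP; apply: contraT => fe.
case: (@arg_minnP _ e (fun e => f e != 0) (fun e => rk ((val e).1 : T)) fe) =>
  e0 fe0 emin.
case/negP: fe0; rewrite -[X in _ == X](jf (val e0).1) /jump (bigD1 e0) //= eqxx.
have [h0 _ _] := edgeP e0.
have -> : (val e0).1 == (val e0).2 = false by apply/negbTE; case/andP: h0.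
rewrite subr0 mulr1 big1 ?addr0 // => e' ne'.
have -> : (val e0).1 == (val e').1 = false.
  by apply: contraNF ne' => /eqP/edge_eq1->.
have [e2|] := eqVneq (val e0).1 (val e').2; last by rewrite subrr mulr0.
have [h' _ _] := edgeP e'.
have [->|fe'] := eqVneq (f e') 0; first by rewrite mul0r.
by have := emin e' fe'; rewrite leqNgt hlt_rk // e2.
Qed.

(** The inverse of [jump]: the value of the chain on the edge that starts at [v]. *)
Definition label_sum (al : T -> k) v : k :=
  \sum_(z : T | (label z == label v) && (rk z <= rk (v : T))%N) al z.

Lemma ex_next v z : label z = label v -> (rk (v : T) < rk (z : T))%N ->
  exists e, (val e).1 = v.
Proof.
move=> lz vz; pose Q w := (label w == label v) && (rk (v : T) < rk (w : T))%N.
have Qz : Q z by rewrite /Q lz eqxx.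
case: (@arg_minnP _ z Q (fun w => rk (w : T)) Qz) => y /andP[/eqP ly vy] ymin.
suff ed : is_edge (v, y) by exists (Sub (v, y) ed).
apply/and3P; split=> /=; rewrite ?ly //.
  by rewrite -rk_hlt //; apply: rconc_eqlab.
apply/existsP => -[w /and3P[/eqP lw vw wy]].
by have := ymin w; rewrite /Q lw eqxx hlt_rk // leqNgt hlt_rk // => /(_ isT).
Qed.

Lemma ex_prev v z : label z = label v -> (rk (z : T) < rk (v : T))%N ->
  exists e, (val e).2 = v.
Proof.
move=> lz zv; pose Q w := (label w == label v) && (rk (w : T) < rk (v : T))%N.
have Qz : Q z by rewrite /Q lz eqxx.
case: (@arg_maxnP _ z Q (fun w => rk (w : T)) Qz) => x /andP[/eqP lx xv] xmax.
suff ed : is_edge (x, v) by exists (Sub (x, v) ed).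
apply/and3P; split=> /=; rewrite ?lx //.
  by rewrite -rk_hlt //; apply: rconc_eqlab.
apply/existsP => -[w /and3P[/eqP lw xw wv]].
by have := xmax w; rewrite /Q lw eqxx hlt_rk // => /(_ isT) /=;
  rewrite leqNgt hlt_ideal_size.
Qed.

Lemma jump_label_sum (al : T -> k) v : jump_cycle [set: T] al ->
  jump [ffun e => label_sum al (val e).1] v = al v.
Proof.
case=> _ _ tot; rewrite /jump; under eq_bigr do rewrite ffunE mulrBr.
rewrite sumrB.
have -> : \sum_(e : edge E) label_sum al (val e).1 * (v == (val e).1)%:R =
  label_sum al v.
  have [[e ev]|nex] := pselect (exists e, (val e).1 = v).
    rewrite (bigD1 e) //= ev eqxx mulr1 big1 ?addr0 // => e' ne'.
    by case: eqP => [e1|_]; [case/eqP: ne'; apply: edge_eq1;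
      rewrite ev | rewrite mulr0].
  rewrite big1 => [|e _]; last by case: eqP => [e1|_]; [case: nex;
    exists e | rewrite mulr0].
  (* No edge starts at [v], the last element with its label; the partial sum is then the total over
     that label, which is zero. *)
  rewrite -[LHS](tot (pred1 (label v))); apply: eq_bigl => z /=.
  case: eqP => //= lz; symmetry; rewrite leqNgt; apply/negP => h.
  by apply: nex; apply: ex_next h.
have split_v : label_sum al v =
    al v + \sum_(z : T | (label z == label v) && (rk z < rk (v : T))%N) al z.
  rewrite /label_sum (bigD1 v) /= ?eqxx ?leqnn //; congr (_ + _).
  apply: eq_bigl => z; case: eqP => //= lz; rewrite [in RHS]ltn_neqAle andbC.
  congr (~~ _ && _); apply/eqP/eqP => [->//|e].
  by apply: (@rk_inj _ _ T) e; apply: rconc_eqlab.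
rewrite split_v -addrA; apply/eqP;
  rewrite -subr_eq0 addrAC subrr add0r subr_eq0 eq_sym; apply/eqP.
have [[e ev]|nex] := pselect (exists e, (val e).2 = v).
  have [h1 l1 u1] := edgeP e.
  rewrite (bigD1 e) //= ev eqxx mulr1 big1 ?addr0; last first.
    move=> e' ne'.
    by case: eqP => [e1|_]; [case/eqP: ne'; apply: edge_eq2;
      rewrite ev | rewrite mulr0].
  rewrite ev in h1 l1 u1; apply: eq_bigl => z; rewrite l1; case: eqP => //= lz.
  have czx : rconc (z : T) (val e).1 by apply: rconc_eqlab; rewrite /= lz -l1.
  have := hlt_rk h1 => h1'; apply/idP/idP => [|zv]; first by move/leq_ltn_trans;
    apply.
  rewrite leqNgt; apply/negP => xz; apply: (u1 z); first by rewrite lz -l1.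
    by rewrite -rk_hlt // rconcC.
  by rewrite -rk_hlt //; apply: rconc_eqlab.
rewrite big1 => [|e _]; last by case: eqP => [e1|_]; [case: nex;
  exists e | rewrite mulr0].
rewrite big_pred0 // => z; apply/negP => /andP[/eqP lz zv].
by apply: nex; apply: ex_prev zv.
Qed.

Lemma acyclicE : acyclic k E <-> racyclic k [set: T].
Proof.
split=> ac.
  move=> al jc v; pose f : chain1 k E := [ffun e => label_sum al (val e).1].
  have jE w : jump f w = al w by apply: jump_label_sum jc.
  suff f0 : f = 0 by rewrite -jE f0 /jump big1 // => e _; rewrite ffunE mul0r.
  apply: ac; apply/ffunP => w; rewrite boundary_jump ffunE.
  by case: jc => _ cyc _; rewrite -[RHS](cyc w) ?inE //; apply: eq_bigr => z _.
move=> f bf; apply: jump_inj; apply: ac; split=> [w|v _|Q].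
- by rewrite inE.
- by rewrite -boundary_jump bf ffunE.
- by rewrite (@sum_jump f (fun w => Q (label w))) big1 // => e _;
  case: (edgeP e) => _ -> _; rewrite subrr mulr0.
Qed.

End AcyclicHeap.

(** * Strong acyclicity, P2 and regularity *)

Section StrongAcyclicity.

Variables (P : choiceType) (C : concurrency P).

Lemma strongly_acyclicE k (E : heap C) :
  strongly_acyclic k E <-> rstrong k [set: of_heap E].
Proof.
have delE (v : E) : acyclic k (hdel v) <-> racyclic k ([set: of_heap E] :\ v).
  by rewrite acyclicE racyclic_subheap setTD.
split=> -[ac dac]; split; try exact/acyclicE.
  by move=> v _; apply/delE.
by move=> v; apply/delE; apply: dac; rewrite inE.
Qed.

(** A square is a cycle of [E], and a braid chain turns into a square once its middle element is
    deleted. *)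
Lemma strongly_acyclic_propP2 k (E : heap C) : strongly_acyclic k E -> propP2 E.
Proof.
move/strongly_acyclicE=> [ac dac]; apply/propP2_reduced; split=> [x y s|x t y b].
  exact: racyclic_sq s ac.
case: b => [] [xA tA yA] [xt ty] lxy [ltx ctx] bxy.
apply: (@racyclic_sq _ _ k _ ([set: of_heap E] :\ t) x y _ (dac t tA)).
split; rewrite ?in_setD1 ?xA ?yA ?andbT //.
- by apply/eqP => e; rewrite e ltnn in xt.
- by apply/eqP => e; rewrite e ltnn in ty.
- exact: ltn_trans ty.
- by move=> z /setD1P[/eqP zt zA] h1 h2; apply/negP => /(bxy z zA h1 h2).
Qed.

(** That [b] is maximal after the deletion of [a] but not before means that [a] is the only
    concurrent element above [b]. *)
Lemma hprec_plusE (E : heap C) (a : E) : hprec_plus a <->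
  exists b, rprec [set: of_heap E] a b.
Proof.
split=> [[/hmaxP amax [b [/hmaxP bmax bN lba]]] | [b [_ ta ba [cba lba] ub]]].
  have only (z : of_heap E) : rconc z (val b : of_heap E) ->
      rk (val b : of_heap E) < rk z -> z = a.
    move=> czb bz; apply: contrapT => /eqP nza.
    have zF : z \in [set~ a] by rewrite !inE.
    apply: (bmax (Sub z zF)); rewrite hlt_subheap ?SubK //;
      last by rewrite conc_sym.
    by rewrite -rk_hlt // rconcC.
  have [z bz] : exists z, hlt (val b) z.
    by apply: contrapT => h; case/hmaxP: bN => z bz; apply: h; exists z.
  have [w [bw cbw _]] := hlt_first bz; clear z bz.
  have ew : w = a by apply: only; [rewrite rconcC | exact: hlt_rk].
  subst w; exists (val b); split; rewrite ?inE //.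
  - move=> z _ cza; rewrite leqNgt; apply/negP => az; apply: (amax z).
    by rewrite -rk_hlt // rconcC.
  - exact: hlt_rk.
  - by move=> z _; apply: only.
have amax z : ~ hlt a z.
  move=> az; have [w [aw caw _]] := hlt_first az.
  by have := ta w (in_setT _); rewrite rconcC leqNgt hlt_rk // => /(_ caw).
split; first exact/hmaxP.
have hba : hlt (b : E) a by rewrite -rk_hlt.
have bF : b \in [set~ a] by rewrite !inE; case/andP: hba.
exists (Sub b bF); split; rewrite ?SubK //.
  apply/hmaxP => z /hlt_first[w [bw cbw _]].
  rewrite hlt_subheap // SubK in bw.
  have ew : val w = a by apply: ub; rewrite ?inE // ?hlt_rk // rconcC.
  by have := valP w; rewrite /= ew !inE eqxx.
by apply/hmaxP => /(_ a).
Qed.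

Lemma hprec_minusE (E : heap C) (a : E) : hprec_minus a <->
  exists b, rprec (T := rrev (of_heap E)) [set: of_heap E] a b.
Proof.
have rlt (x y : of_heap E) : (rk (x : rrev (of_heap E)) < rk (y :
  rrev (of_heap E))) = (rk y < rk x).
  exact: rev_rkE.
split=> [[/hminP amin [b [/hminP bmin bN lba]]] | [b [_ ta ba [cba lba] ub]]].
  have only (z : of_heap E) : rconc z (val b : of_heap E) ->
      rk z < rk (val b : of_heap E) -> z = a.
    move=> czb zb; apply: contrapT => /eqP nza.
    have zF : z \in [set~ a] by rewrite !inE.
    by apply: (bmin (Sub z zF)); rewrite hlt_subheap ?SubK // -rk_hlt.
  have [z zb] : exists z, hlt z (val b).
    by apply: contrapT => h; case/hminP: bN => z bz; apply: h; exists z.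
  have [w [_ cwb wb]] := hlt_last zb; clear z zb.
  have ew : w = a by apply: only => //; exact: hlt_rk.
  subst w; exists (val b); split; rewrite ?inE ?rlt //.
  - move=> z _ cza; rewrite leqNgt rlt; apply/negP => za; apply: (amin z).
    by rewrite -rk_hlt.
  - exact: hlt_rk.
  - by split=> //; rewrite rconcC.
  - by move=> z _ czb; rewrite rlt; apply: only.
rewrite rlt in ba.
have amin z : ~ hlt z a.
  move=> za; have [w [_ cwa wa]] := hlt_last za.
  by have := ta w (in_setT _) cwa; rewrite leqNgt rlt hlt_rk.
split; first exact/hminP.
have hab : hlt a (b : E) by rewrite -rk_hlt // rconcC.
have bF : b \in [set~ a] by rewrite !inE eq_sym; case/andP: hab.
exists (Sub b bF); split; rewrite ?SubK //.
  apply/hminP => z /hlt_last[w [_ cwb wb]].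
  rewrite hlt_subheap // SubK in wb.
  have ew : val w = a by apply: (ub (val w)); rewrite ?inE // rlt hlt_rk.
  by have := valP w; rewrite /= ew !inE eqxx.
by apply/hminP => /(_ a).
Qed.

Lemma htrivialE (E : heap C) : htrivial E <-> tops (of_heap E) = setT.
Proof.
split=> [triv|topE a b ab].
  apply/setP => a; rewrite [RHS]inE; apply/topsP => z cza; rewrite leqNgt;
    apply/negP.
  rewrite rk_hlt; last by rewrite rconcC.
  by case/andP=> /eqP naz /triv.
apply: contrapT => /eqP nab; have [|w [aw caw _]] := @hlt_first _ _ E a b.
  by rewrite /hlt /= nab.
have /topsP/(_ w) : (a : of_heap E) \in tops (of_heap E) by rewrite topE inE.
by rewrite rconcC leqNgt hlt_rk // => /(_ caw).
Qed.

(** By induction on the size of [E]; P1 serves only to provide one predecessor, and a predecessor at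
    the bottom is treated in the reversed heap. *)
Lemma regular_strongly_acyclic k (E : heap C) : regular C -> propP2 E ->
  strongly_acyclic k E.
Proof.
move=> reg; have [n] := ubnP #|E|; elim: n E => // n IH E /ltnSE-En p2.
apply/strongly_acyclicE.
(* The induction hypothesis is needed for all proper reduced subsets, since [rstrong_prec] also
   removes [b]. *)
have IHA (A : {set of_heap E}) : A != setT -> reduced A -> rstrong k A.
  move=> AT redA; have /IH : #|subheap (A : {set E})| < n.
    apply: leq_trans En; rewrite card_sig.
    by rewrite -[X in _ < X]cardsT; apply: proper_card;
      rewrite properE subsetT subTset.
  case/(_ ((propP2_subheap (A : {set E})).2 redA))/strongly_acyclicE => ac dac.
  split; first exact/racyclic_subheap.
  move=> v vA; have := dac (Sub v vA); rewrite inE => /(_ isT).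
  by move/racyclic_subheapD1; rewrite SubK.
have redE : reduced [set: of_heap E] by apply/propP2_reduced.
have p1 := reg E p2; clear p2 En; case: p1 redE IHA => {}E.
  move/htrivialE=> topE _ _; split=> [|v _]; exact: racyclic_tops.
move=> E' _ [a [_ [/hprec_plusE|/hprec_minusE] [b prec]]] redE IHA.
  exact: rstrong_prec prec.
have revE (A : {set of_heap E'}) :
    rstrong k (A : {set rrev (of_heap E')}) <-> rstrong k A.
  split=> -[ac dac]; split=> [|v vA].
  - exact: (racyclic_rev k A).2 ac.
  - exact: (racyclic_rev k (A :\ v)).2 (dac v vA).
  - exact: (racyclic_rev k A).1 ac.
  - exact: (racyclic_rev k (A :\ v)).1 (dac v vA).
apply/revE; apply: (rstrong_prec _ _ prec); last exact/reduced_rev.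
by move=> A AT redA; apply/revE; apply: IHA => //; apply/reduced_rev.
Qed.

End StrongAcyclicity.

(** * Words as linear extensions of ranked heaps *)

Section Words.

Variables (P : choiceType) (C : concurrency P).

Definition before (T : rheap C) : rel T := fun a b => rconc a b ==> (rk a <= rk b).

(** A linear extension of the heap on [A]; only concurrent pairs are constrained. *)
Definition listing (T : rheap C) (A : {set T}) (L : seq T) :=
  [/\ uniq L, L =i A & pairwise (@before T) L].

Lemma before_lt (T : rheap C) (a b : T) :
  before a b -> rconc a b -> a <> b -> rk a < rk b.
Proof.
move=> /implyP ab cab nab; case: (rk_neq cab nab) => // h.
by have := ab cab; rewrite leqNgt h.
Qed.

Lemma before_mid (T : rheap C) (L1 L2 : seq T) a :
  pairwise (@before T) (L1 ++ a :: L2) ->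
  (forall z, z \in L1 -> before z a) /\ (forall z, z \in L2 -> before a z).
Proof.
rewrite pairwise_cat /= => /and3P[/allrelP h _ /andP[/allP h' _]].
by split=> // z zL; apply: h; rewrite // inE eqxx.
Qed.

Definition rsort (T : rheap C) (A : {set T}) : seq T :=
  sort (fun a b => rk a <= rk b) (enum A).

Lemma rsort_listing (T : rheap C) (A : {set T}) : listing A (rsort A).
Proof.
split; first by rewrite sort_uniq enum_uniq.
  by move=> a; rewrite mem_sort mem_enum.
have tr : transitive (fun a b : T => rk a <= rk b) by move=> y x z;
  apply: leq_trans.
have : sorted (fun a b => rk a <= rk b) (rsort A).
  by apply: sort_sorted => a b; apply: leq_total.
rewrite sorted_pairwise //; apply: sub_pairwise => a b ab.
by apply/implyP.
Qed.

Lemma commutes_front a X Y : all (fun p => ~~ C p a) X ->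
  commutes C (X ++ a :: Y) (a :: X ++ Y).
Proof.
elim: X => [|p X IH] /=; first by move=> _; apply: commutes_refl.
case/andP=> pa /IH h; apply: (@commutes_trans _ _ _ (p :: a :: X ++ Y)).
  exact: (commutes_catl [:: p]).
exact: (commutes_swap [::] _ pa).
Qed.

(** No element that precedes the head of [L] in [L'] is concurrent with it, so that head can be
    moved to the front of [L']; then induct. *)
Lemma listing_commutes (T : rheap C) (A : {set T}) L L' :
  listing A L -> listing A L' ->
    commutes C [seq rlab a | a <- L] [seq rlab a | a <- L'].
Proof.
elim: L A L' => [|a L IH] A L' [uL LA oL] [uL' L'A oL'].
  case: L' uL' L'A oL' => [|b L'] // _ L'A _; first exact: commutes_refl.
  by have := L'A b; rewrite -LA inE eqxx.
have aL' : a \in L' by rewrite L'A -LA inE eqxx.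
move: uL' L'A oL'; case/splitPr: aL' => X Y uL' L'A oL'.
have [Xa _] := before_mid oL'.
have [_ aL] := before_mid (L1 := [::]) oL.
move: uL; rewrite /= => /andP[naL uL].
move: (uL'); rewrite uniq_catC cat_cons cons_uniq mem_cat negb_or =>
  /andP[/andP[aY aX] _].
have nX : all (fun p => ~~ C p (rlab a)) [seq rlab x | x <- X].
  rewrite all_map; apply/allP => x xX /=; apply/negP => cxa.
  have nxa : x <> a by move=> e; rewrite -e xX in aX.
  have xL : x \in L.
    have : x \in a :: L by rewrite LA -L'A mem_cat xX.
    by rewrite inE => /orP[/eqP|].
  have h1 := before_lt (Xa x xX) cxa nxa.
  by have := before_lt (aL x xL) ltac:(by rewrite rconcC) (nesym nxa); rklia.
apply: commutes_sym; rewrite map_cat map_cons.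
apply: commutes_trans (commutes_front _ nX) _; apply: commutes_sym.
rewrite /= -map_cat; apply: (commutes_catl [:: rlab a]); apply: (IH (A :\ a)).
  split=> //; last by case/andP: oL.
  by move=> z; rewrite in_setD1 -LA inE; case: eqVneq => [->|] //=;
    rewrite (negPf naL).
split.
- by move: uL'; rewrite uniq_catC cat_cons cons_uniq uniq_catC => /andP[].
- move=> z; rewrite in_setD1 -L'A !mem_cat inE.
  by case: eqVneq => [->|] //=; rewrite (negPf aX) (negPf aY).
- move: oL'; rewrite !pairwise_cat /= => /and3P[/allrelP h1 -> /andP[_ ->]].
  by rewrite !andbT; apply/allrelP => p q pX qY; apply: h1; rewrite // inE qY orbT.
Qed.

Definition word_lab (w : seq P) (i : 'I_(size w)) := tnth (in_tuple w) i.

Lemma word_rk_inj (w : seq P) (i j : 'I_(size w)) :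
  C (word_lab i) (word_lab j) -> val i = val j -> i = j.
Proof. by move=> _ /val_inj. Qed.

Definition of_word (w : seq P) : rheap C := RHeap (@word_rk_inj w).

Definition wreduced w := reduced [set: of_word w].
Definition walive w := alive [set: of_word w].

Lemma of_word_listing w :
  exists2 L : seq (of_word w), listing setT L & [seq rlab a | a <- L] = w.
Proof.
exists (enum 'I_(size w)); last exact: (map_tnth_enum (in_tuple w)).
split; first exact: enum_uniq.
  by move=> i; rewrite in_setT; exact: (mem_enum 'I_(size w) i).
have := iota_ltn_sorted 0 (size w); rewrite -val_enum_ord sorted_map.
rewrite sorted_pairwise; last by move=> j i l; apply: ltn_trans.
apply: sub_pairwise => i j /= ij; apply/implyP => _; exact: ltnW.
Qed.

(* Hides the dependency of the ranked heap on [w], which blocks rewriting. *)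
Lemma word_model w : exists (T : rheap C) (L : seq T),
  listing setT L /\ [seq rlab a | a <- L] = w.
Proof. by have [L] := of_word_listing w; exists (of_word w), L. Qed.

Section Hub.

Variables (T : rheap C) (A : {set T}) (L : seq T).
Hypothesis lL : listing A L.

Let f (i : of_word [seq rlab a | a <- L]) : T :=
  tnth (in_tuple L) (cast_ord (size_map _ _) i).

(** On concurrent elements, positions in a listing and ranks compare alike, so the heap of a word is
    a copy of any heap that the word lists. *)
Lemma listing_rembed : rembed f setT /\ f @: setT = A.
Proof.
case: lL => uL LA oL.
have fnth x0 i : f i = nth x0 L i by rewrite /f (tnth_nth x0).
split; first split.
- move=> i j _ _; rewrite (fnth (f i) i) (fnth (f i) j) => /eqP;
  rewrite nth_uniq //.
  + by move/eqP/val_inj.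
  + by rewrite -(size_map (@rlab _ _ T)) ltn_ord.
  + by rewrite -(size_map (@rlab _ _ T)) ltn_ord.
- move=> i _; rewrite /= /word_lab (tnth_nth (rlab (f i))) /= (nth_map (f i))
  -?fnth //.
  by rewrite -(size_map (@rlab _ _ T)) ltn_ord.
- have half i j : rconc (f i) (f j) -> rk i < rk j -> rk (f i) < rk (f j).
    move=> cij ij; have hi : i < size L
      by rewrite -(size_map (@rlab _ _ T)) ltn_ord.
    have hj : j < size L by rewrite -(size_map (@rlab _ _ T)) ltn_ord.
    apply: before_lt => //.
      by move/(pairwiseP (f i)): oL => /(_ i j hi hj ij); rewrite -!fnth.
    move=> /eqP; rewrite (fnth (f i) i) (fnth (f i) j) nth_uniq //.
    by move/eqP => e; move: ij; rewrite /= e ltnn.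
  have labE i : rlab (f i) = rlab i.
    rewrite /= /word_lab (tnth_nth (rlab (f i))) /= (nth_map (f i)) -?fnth //.
    by rewrite -(size_map (@rlab _ _ T)) ltn_ord.
  move=> i j _ _ cij; have cij' : rconc (f i) (f j) by rewrite /rconc !labE.
  apply/idP/idP; last exact: half.
  move=> h; have [e|/eqP nij] := eqVneq i j; first by rewrite e ltnn in h.
  case: (rk_neq cij nij) => // h'.
  by have := half j i; rewrite rconcC cij' h' => /(_ isT isT); rklia.
apply/setP => z; rewrite -LA; apply/imsetP/idP => [[i _ ->]|zL].
  by rewrite /f mem_tnth.
have hz : index z L < size [seq rlab a | a <- L] by rewrite size_map index_mem.
by exists (Ordinal hz); rewrite ?inE // (fnth z) /= nth_index.
Qed.

Lemma listing_reduced : reduced A <-> wreduced [seq rlab a | a <- L].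
Proof. by have [fe <-] := listing_rembed; apply: reduced_imset. Qed.

Lemma listing_alive : alive A <-> walive [seq rlab a | a <- L].
Proof. by have [fe <-] := listing_rembed; apply: alive_imset. Qed.

End Hub.

Lemma map_eq_cat (U : Type) (g : U -> P) L X Y : [seq g a | a <- L] = X ++ Y ->
  exists L1 L2, [/\ L = L1 ++ L2,
    [seq g a | a <- L1] = X & [seq g a | a <- L2] = Y].
Proof.
move=> e; exists (take (size X) L), (drop (size X) L).
by rewrite cat_take_drop map_take map_drop e take_size_cat // drop_size_cat.
Qed.

(** Words that differ by swapping two commuting letters list the same ranked heap. *)
Lemma walive_commutes u v : commutes C u v -> walive u <-> walive v.
Proof.
elim=> {u v} [X Y s t cst|u|u v _ -> //|u v w _ -> _ -> //] //.
have [T [L [[uL LA oL] /[dup] eL]]] := word_model (X ++ [:: s; t] ++ Y).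
case/map_eq_cat=> L1 [R [eLR e1 eR]].
case: R eR eLR => [|a [|b L2]] // [ea eb e2] eLR.
have l1 : listing setT L by [].
have l2 : listing setT (L1 ++ [:: b, a & L2]).
  split.
  - rewrite (@perm_uniq _ _ L) // eLR perm_cat2l.
    by rewrite (perm_catCA [:: b] [:: a] L2).
  - by move=> z; rewrite -LA eLR !mem_cat !inE; do 2!case: eqP => _; rewrite ?orbT.
  - move: oL; rewrite eLR !pairwise_cat /= =>
    /and3P[/allrelP h1 -> /and3P[/andP[h2 h3] h4 ->]].
    have nba : rconc b a = false by rewrite /rconc ea eb conc_sym; apply/negbTE.
    rewrite h3 h4 !andbT /before nba /= andbT.
    apply/allrelP => p q pL qR; apply: h1 => //.
    by move: qR; rewrite !inE => /or3P[->|->|->]; rewrite ?orbT.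
have := listing_alive l2; have := listing_alive l1.
by rewrite eL map_cat /= ea eb e1 e2 => ->.
Qed.

Section Factors.

Variables (T : rheap C) (A : {set T}) (L1 L2 : seq T).

Lemma listing_br x t y : listing A (L1 ++ [:: x, t, y & L2]) ->
  rlab x = rlab y -> rlab t <> rlab x -> rconc t x -> br A x t y.
Proof.
case=> uL LA oL lxy ltx ctx.
have [L1x xR] := before_mid oL.
have [L1t tR] := before_mid (L1 := L1 ++ [:: x]) (a := t) (L2 :=
  y :: L2) ltac:(by rewrite -catA).
have [L1y yR] := before_mid (L1 := L1 ++ [:: x;
  t]) (a := y) (L2 := L2) ltac:(by rewrite -catA).
have cty : rconc t y by rewrite -(rconc_lab _ lxy).
have nty : t <> y by move=> e; case: ltx; rewrite e lxy.
split=> //.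
- by rewrite -!LA !mem_cat !inE !eqxx !orbT.
- split; apply: before_lt => //.
  + by apply: xR; rewrite inE eqxx.
  + by rewrite rconcC.
  + by move=> e; case: ltx; rewrite e.
  + by apply: tR; rewrite inE eqxx.
move=> z; rewrite -LA mem_cat !inE => zL xz zy czx.
have czy : rconc z y by rewrite -(rconc_lab _ lxy).
case/or3P: zL => [/L1x/implyP/(_ czx)|/eqP e|/or3P[/eqP//|/eqP e|/yR/implyP]].
- by rewrite leqNgt xz.
- by rewrite e ltnn in xz.
- by rewrite e ltnn in zy.
- by rewrite rconcC => /(_ czy); rewrite leqNgt zy.
Qed.

Lemma listing_sq x y : listing A (L1 ++ [:: x, y & L2]) ->
  rlab x = rlab y -> sq A x y.
Proof.
case=> uL LA oL lxy.
have [L1x xR] := before_mid oL.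
have [L1y yR] := before_mid (L1 := L1 ++ [:: x]) (a := y) (L2 :=
  L2) ltac:(by rewrite -catA).
have cxy := rconc_eqlab lxy.
split=> //.
- by rewrite -!LA !mem_cat !inE !eqxx !orbT.
- by rewrite -!LA !mem_cat !inE !eqxx !orbT.
- apply: before_lt => //; first by apply: xR; rewrite inE eqxx.
  move: uL; rewrite uniq_catC /= inE => /andP[+ _] e.
  by rewrite e eqxx.
move=> z; rewrite -LA mem_cat !inE => zL xz zy; apply/negP => czx.
have czy : rconc z y by rewrite -(rconc_lab _ lxy).
case/or4P: zL => [/L1x/implyP/(_ czx)|/eqP e|/eqP e|/yR/implyP].
- by rewrite leqNgt xz.
- by rewrite e ltnn in xz.
- by rewrite e ltnn in zy.
- by rewrite rconcC => /(_ czy); rewrite leqNgt zy.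
Qed.

End Factors.

Lemma listing_drop (T : rheap C) (A : {set T}) (L1 L2 : seq T) a :
  listing A (L1 ++ a :: L2) -> listing (A :\ a) (L1 ++ L2).
Proof.
case=> uL LA oL; move: (uL);
  rewrite uniq_catC cat_cons cons_uniq uniq_catC => /andP[naL uL'].
split=> //.
- move=> z; rewrite in_setD1 -LA !mem_cat inE; case: eqVneq => [->|] //=.
  by apply/negbTE; move: naL; rewrite !mem_cat orbC.
- move: oL; rewrite !pairwise_cat /= => /and3P[/allrelP h1 -> /andP[_ ->]].
  by rewrite !andbT; apply/allrelP => p q pX qY; apply: h1; rewrite // inE qY orbT.
Qed.

Lemma walive_braid X Y s t : s != t -> C s t ->
  walive (X ++ [:: s; t; s] ++ Y) <-> walive (X ++ [:: s] ++ Y).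
Proof.
move=> st cst.
have [T [L [lL /[dup] eL]]] := word_model (X ++ [:: s; t; s] ++ Y).
case/map_eq_cat=> L1 [R [eLR e1 eR]]; have := listing_alive lL; rewrite eL => <-.
case: R eR eLR => [|x [|z [|y L2]]] // [ex ez ey e2] eLR; rewrite eLR in lL.
have b : br setT x z y.
  apply: listing_br lL _ _ _; rewrite ?ex ?ey ?ez //; first by apply/eqP;
    rewrite eq_sym.
  by rewrite /rconc ex ez conc_sym.
have l2 : listing (setT :\ z :\ y) ((L1 ++ [:: x]) ++ L2).
  apply: listing_drop; rewrite -catA; change ([:: x] ++ y :: L2) with ([:: x;
    y] ++ L2).
  have := @listing_drop _ _ (L1 ++ [:: x]) (y :: L2) z; rewrite -!catA /=; exact.
have := listing_alive l2; rewrite -catA !map_cat /= e1 e2 ex => <-.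
exact: alive_brE b.
Qed.

Lemma walive_square X Y s : ~ walive (X ++ [:: s; s] ++ Y).
Proof.
have [T [L [lL /[dup] eL]]] := word_model (X ++ [:: s; s] ++ Y).
case/map_eq_cat=> L1 [R [eLR e1 eR]]; have := listing_alive lL; rewrite eL => <-.
case: R eR eLR => [|x [|y L2]] // [ex ey e2] eLR; rewrite eLR in lL.
by move/alive_sq; apply; apply: listing_sq lL _; rewrite ex ey.
Qed.

Lemma rk_hle (E : heap C) (a b : of_heap E) : rconc a b -> (rk a <= rk b) = hle a b.
Proof.
move=> cab; rewrite leqNgt rk_hlt; last by rewrite rconcC.
have [<-|nab] := eqVneq a b; first by rewrite hlt_irr hle_refl.
apply/idP/idP => [nba|ab].
  case/orP: (hle_conc cab) => // ba; case/negP: nba.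
  by rewrite /hlt /= eq_sym nab.
by apply/negP => /hlt_le_trans/(_ ab); rewrite hlt_irr.
Qed.

Lemma heap_word_listing (E : heap C) : exists2 L : seq (of_heap E),
  listing setT L & [seq rlab a | a <- L] = heap_word E.
Proof.
exists (rsort [set: of_heap E]); first exact: rsort_listing.
rewrite /heap_word /hlinear /rsort; congr (map _ (sort _ _)).
by apply: eq_enum => a; rewrite !inE.
Qed.

Lemma word_heap_listing w : exists2 L : seq (of_heap (word_heap C w)),
  listing setT L & [seq rlab a | a <- L] = w.
Proof.
elim: w => [|p w [L [uL LA oL] eL]].
  by exists [::] => //; split=> // -[].
pose T := of_heap (word_heap C (p :: w)).
pose h (a : of_heap (word_heap C w)) : T := inr a.
exists ((inl tt : T) :: map h L).
  split.
  - rewrite /= map_inj_uniq ?uL ?andbT => [|a b []//].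
    by apply/mapP => -[].
  - case=> [[]|a]; first by rewrite inE eqxx inE.
    rewrite inE [RHS]inE /=; apply: map_f; by rewrite LA inE.
  - rewrite pairwise_cons pairwise_map; apply/andP; split.
      apply/allP => _ /mapP[a _ ->]; apply/implyP => c; rewrite rk_hle //.
      exact: connect1.
    apply: sub_pairwise oL => a b /implyP ab.
    apply/implyP => c; rewrite rk_hle //; apply: connect1 => /=.
    by rewrite -rk_hle //; apply: ab.
by rewrite /= -[in RHS]eL -map_comp.
Qed.

Lemma commutes_word_heap w : commutes C (heap_word (word_heap C w)) w.
Proof.
have [L lL eL] := heap_word_listing (word_heap C w).
have [L' lL' eL'] := word_heap_listing w.
by have := listing_commutes lL lL'; rewrite eL eL'.
Qed.

Lemma propP2_word_heap w : propP2 (word_heap C w) <-> wreduced w.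
Proof.
have [L lL eL] := word_heap_listing w.
by rewrite propP2_reduced (listing_reduced lL) eL.
Qed.

Lemma heap_word_subheap (E : heap C) (F : {set E}) L :
  listing (F : {set of_heap E}) L ->
  commutes C (heap_word (subheap F)) [seq rlab a | a <- L].
Proof.
move=> lL; have [L' [uL L'A oL] <-] := heap_word_listing (subheap F).
pose g (a : of_heap (subheap F)) : of_heap E := val a.
have -> : [seq rlab a | a <- L'] = [seq rlab a | a <- map g L']
  by rewrite -map_comp.
apply: listing_commutes lL; split.
- by rewrite map_inj_uniq // => a b /val_inj.
- move=> z; apply/mapP/idP => [[a _ ->]|zF]; first exact: (valP a).
  by exists (Sub z zF); rewrite // L'A inE.
- rewrite pairwise_map; apply: sub_pairwise oL => a b /implyP ab.
  apply/implyP => cab; have := ab cab.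
  by rewrite rk_hle // => /subheap_sub h; rewrite rk_hle.
Qed.

End Words.

(** * The element delta is not invertible *)

Section DeltaNonunit.

Import GRing.Theory.
Local Open Scope ring_scope.

(* Evaluation at v = 1 sends delta to 2. *)
Lemma delta_nonunit (l : laurent) : delta * l <> -1.
Proof.
have /asboolP[p [n lE]] := laurentP l; set v := frac_v in lE.
have v0 : v != 0 := frac_v_neq0.
have valM (a b : laurent) :
  laurent_val (a * b) = laurent_val a * laurent_val b by [].
have valD (a b : laurent) :
  laurent_val (a + b) = laurent_val a + laurent_val b by [].
have valN1 : laurent_val (-1) = -1 by [].
move/(congr1 laurent_val); rewrite valM valD valN1 lE /= -/v => e.
(* Multiplication by the power [n.+1] of [v] brings the equation into the polynomial ring, where at
   1 it makes an even integer equal to -1. *)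
have {e} : (v ^+ 2 + 1) * FracField.tofrac p = - v ^+ n.+1.
  rewrite -[RHS]mulN1r -e [in RHS]exprSr -!mulrA (mulrA _ (v ^+ n)).
  rewrite mulVf ?expf_neq0 // mul1r (mulrC _ v) [RHS]mulrA [in RHS]mulrDl.
  by rewrite mulVf // expr2.
rewrite /v /frac_v -tofracXn -tofrac1 -tofracXn -tofracN -tofracD -tofracM => /eqP.
rewrite tofrac_eq => /eqP/(congr1 (fun q => q.[1])).
by rewrite !hornerE !expr1n; lia.
Qed.

End DeltaNonunit.

(** * Aliveness detected in the algebra [TL] *)

Section TemperleyLieb.

Import GRing.Theory.
Local Open Scope ring_scope.
Local Open Scope quotient_scope.

Variables (P : choiceType) (C : concurrency P).

Local Notation cm := (cmonoid C).

Lemma tl_word_commutes u v : commutes C u v -> tl_word C u = tl_word C v.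
Proof. by move=> uv; congr (\pi_(TL C) << _ >>); apply/eqP/cmonoid_eqP. Qed.

Lemma tl_word_braid_cat X Y s t : s != t -> C s t ->
  tl_word C (X ++ [:: s; t; s] ++ Y) = tl_word C (X ++ [:: s] ++ Y).
Proof. by move=> st cst; rewrite !tl_word_cat tl_word_braid. Qed.

Lemma commutes_around s X : all (fun p =>
  ~~ C p s) X -> commutes C (s :: X) (X ++ [:: s]).
Proof. by move=> h; apply: commutes_sym; have := commutes_front [::] h;
  rewrite cats0. Qed.

(** Up to commutation, [x] and [y] can be brought next to [t], where the braid relation applies. *)
Lemma tl_word_br (T : rheap C) (A : {set T}) x t y : br A x t y ->
  tl_word C [seq rlab a | a <- rsort A] =
  tl_word C [seq rlab a | a <- rsort (A :\ t :\ y)].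
Proof.
case=> [] [xA tA yA] [xt ty] lxy [ltx ctx] bxy.
have [L [lL exR]] : exists L, listing A L /\ L = rsort A.
  by exists (rsort A); split=> //; apply: rsort_listing.
rewrite -{}exR.
have cty : rconc t y by rewrite -(rconc_lab _ lxy).
have nlt (a b : T) : before a b -> rconc a b -> (rk b < rk a)%N -> False.
  by move=> /implyP ab /ab; rewrite leqNgt => /negbTE->.
case: (lL) => uL LA oL.
have xL : x \in L by rewrite LA.
move: uL LA oL lL; case/splitPr: xL => L1 R uL LA oL lL.
have [L1x xR] := before_mid oL.
have tR : t \in R.
  have : t \in L1 ++ x :: R by rewrite LA.
  rewrite mem_cat inE => /or3P[/L1x h|/eqP e|//]; last by case: ltx; rewrite e.
  by case: (nlt t x h).
move: xR uL LA oL lL; case/splitPr: tR => M1 R2 xR uL LA oL lL.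
have oL2 : pairwise (@before P C T) ((L1 ++ x :: M1) ++ t :: R2) by rewrite -catA.
have [Mt tR] := before_mid oL2.
have yR : y \in R2.
  have : y \in (L1 ++ x :: M1) ++ t :: R2 by rewrite -catA LA.
  rewrite mem_cat inE => /or3P[/Mt h|/eqP e|//]; last by case: ltx; rewrite -e.
  by case: (nlt y t h) => //; rewrite rconcC.
move: tR xR uL LA oL lL oL2; case/splitPr: yR => M2 L2 tR xR uL LA oL lL _.
have oL3 : pairwise (@before P C T) ((L1 ++ x :: M1 ++ t :: M2) ++ y :: L2).
  by rewrite -!catA /= -!catA.
have [My _] := before_mid oL3.
(* A letter listed between [x] and [y] and concurrent with them would lie between them in rank,
   hence would be [t]. *)
have mid z : z \in M1 ++ M2 -> ~~ C (rlab z) (rlab x).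
  move=> zM; apply/negP => czx.
  have zL : z \in A by rewrite -LA !(mem_cat, inE); move: zM;
    rewrite mem_cat => /orP[]->; rewrite ?orbT.
  have czy : rconc z y by rewrite -(rconc_lab _ lxy).
  have [nzx nzt nzy] : [/\ z <> x, z <> t & z <> y].
    have : uniq ([:: x; t; y] ++ (M1 ++ M2) ++ L1 ++ L2).
      rewrite (@perm_uniq _ _ (L1 ++ x :: M1 ++ t :: M2 ++ y :: L2)) //.
      by apply/permP => q; do !rewrite count_cat /=; clear; lia.
    rewrite cat_uniq => /and3P[_ /hasPn h _].
    have : z \notin [:: x; t; y] by apply: h; rewrite mem_cat zM.
    by rewrite !inE !negb_or => /and3P[/eqP ? /eqP ? /eqP ?].
  apply: nzt; apply: bxy => //.
    apply: before_lt (nesym nzx); last by rewrite rconcC.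
    by apply: xR; move: zM; rewrite !(mem_cat, inE) => /orP[]->; rewrite ?orbT.
  apply: before_lt => //; apply: My.
  by move: zM; rewrite !(mem_cat, inE) => /orP[]->; rewrite ?orbT.
have a1 : all (fun p => ~~ C p (rlab x)) [seq rlab z | z <- M1].
  by rewrite all_map; apply/allP => z zM; apply: mid; rewrite mem_cat zM.
have a2 : all (fun p => ~~ C p (rlab x)) [seq rlab z | z <- M2].
  by rewrite all_map; apply/allP => z zM; apply: mid; rewrite mem_cat zM orbT.
have l2 : listing (A :\ t :\ y) (L1 ++ x :: M1 ++ M2 ++ L2).
  have := @listing_drop _ _ _ _ (L1 ++ x :: M1) (M2 ++ y :: L2) t.
  rewrite -!catA /= => /(_ _ lL).
  have := @listing_drop _ _ _ (A :\ t) (L1 ++ x :: M1 ++ M2) L2 y.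
  by rewrite -!catA /= -!catA => h /h.
rewrite -(tl_word_commutes (listing_commutes l2 (rsort_listing _))).
rewrite !(map_cat, map_cons) -lxy.
set X := map _ L1; set M := map _ M1; set N := map _ M2; set Y := map _ L2.
transitivity (tl_word C ((X ++ M) ++ [:: rlab x; rlab t; rlab x] ++ N ++ Y)).
  apply: tl_word_commutes; rewrite -!catA; apply: commutes_catl.
  apply: (@commutes_trans _ _ _ (M ++ [:: rlab x] ++ rlab t :: N ++ rlab x :: Y)).
    by have := commutes_catr (rlab t :: N ++ rlab x :: Y) (commutes_around a1);
      rewrite -catA.
  apply: commutes_catl; apply: (commutes_catl [:: rlab x; rlab t]).
  by have := commutes_front Y a2.
rewrite tl_word_braid_cat; last 2 first.
- by apply/eqP; apply: nesym.
- by rewrite conc_sym.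
apply: tl_word_commutes; rewrite -!catA; apply: commutes_catl.
apply: commutes_sym.
by have := commutes_catr (N ++ Y) (commutes_around a1); rewrite -catA.
Qed.

(** Braid moves keep the value in [TL] and, without squares, can only stop at a reduced heap. *)
Lemma alive_monomial_basis (T : rheap C) (A : {set T}) : alive A ->
  monomial_basis (tl_word C [seq rlab a | a <- rsort A]).
Proof.
elim/card_set_ind: A => A IH aA.
have [red|nred] := pselect (reduced A).
  exists (word_heap C [seq rlab a | a <- rsort A]).
    by apply/propP2_word_heap/(listing_reduced (rsort_listing A)).
  exact/tl_word_commutes/commutes_sym/commutes_word_heap.
have [x [t [y b]]] : exists x t y, br A x t y.
  apply: contrapT => h; apply: nred; split=> [x y|x t y b];
    first exact: alive_sq aA.
  by apply: h; exists x, t, y.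
rewrite (tl_word_br b); apply: IH; last exact: alive_br aA b.
apply: proper_card; apply/properP; case: (b) => [] [_ tA _] _ _ _ _.
split; last by exists t; rewrite // mem_D2 eqxx andbF.
by apply/subsetP => z; rewrite mem_D2 => /and3P[].
Qed.

Lemma pi_mulU (c d : laurent) (u v : seq P) :
  << c *g \pi_cm u >> * << d *g \pi_cm v >> = << c * d *g \pi_cm (u ++ v) >>
  :> calgebra C.
Proof. by rewrite malgM_def fgmulUU /mmul /= cm_mul_pi. Qed.

Definition malive (m : cm) : bool := `[< walive C (repr m) >].

Lemma malive_pi u : malive (\pi_cm u) = `[< walive C u >].
Proof.
have h : commutes C (repr (\pi_cm u)) u by apply/cmonoid_eqP; rewrite reprK.
by apply/asboolP/asboolP; rewrite (walive_commutes h).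
Qed.

Definition alive_sum : calgebra C -> laurent :=
  mmap (@idfun laurent) (fun m => (malive m)%:R).

Lemma alive_sumD x y : alive_sum (x + y) = alive_sum x + alive_sum y.
Proof. exact: mmapD. Qed.

Lemma alive_sumB x y : alive_sum (x - y) = alive_sum x - alive_sum y.
Proof. exact: mmapB. Qed.

Lemma alive_sum_word c u :
  alive_sum << c *g \pi_cm u >> = c * (`[< walive C u >])%:R.
Proof. by rewrite /alive_sum mmapU malive_pi. Qed.

Definition in_delta (z : laurent) := exists l, z = delta * l.

Lemma in_deltaD x y : in_delta x -> in_delta y -> in_delta (x + y).
Proof. by move=> [l ->] [m ->]; exists (l + m); rewrite mulrDr. Qed.

Lemma in_delta0 : in_delta 0.
Proof. by exists 0; rewrite mulr0. Qed.

Lemma alive_sum_bilinear (x : calgebra C) :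
  (forall c d u v, in_delta (alive_sum (<< c *g \pi_cm u >> * x * << d *g \pi_cm
    v >>))) ->
  forall a b, in_delta (alive_sum (a * x * b)).
Proof.
have sum_delta (I : Type) (r : seq I) (F : I -> calgebra C) :
    (forall i, in_delta (alive_sum (F i))) ->
      in_delta (alive_sum (\sum_(i <- r) F i)).
  move=> hF; elim/big_ind: _ => [|p q hp hq|i _]; last exact: hF.
    by rewrite /alive_sum mmap0; exact: in_delta0.
  by rewrite alive_sumD; apply: in_deltaD.
move=> h a b; rewrite (monalgE a) -mulrA mulr_suml; apply: (sum_delta _) => m.
rewrite mulrA [in X in _ * X](monalgE b) mulr_sumr; apply: sum_delta => m'.
by rewrite -[m]reprK -[m']reprK; apply: h.
Qed.

(** The factors [a] and [b] make the induction pass through the two-sided ideal. A monomial with a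
    factor [ss] is never alive, so the square relation leaves a multiple of [delta]; the two sides
    of a braid relation are alive together. *)
Lemma alive_sum_ideal (x : calgebra C) : tl_ideal_gen x ->
  forall a b, in_delta (alive_sum (a * x * b)).
Proof.
elim=> {x} [x [s|s t st cst]||x y _ hx _ hy|a x _ h|a x _ h] p q.
- apply: alive_sum_bilinear => c d u v.
  have -> : delta *: cword C [:: s] = << delta *g \pi_cm [:: s] >>.
    by apply/malgP => m; rewrite mcoeffZ !mcoeffU mulrnAr mulr1.
  rewrite mulrBr mulrBl !pi_mulU alive_sumB !alive_sum_word -!catA.
  have -> : `[< walive C (u ++ [:: s; s] ++ v) >] = false.
    by apply/asboolP; apply: walive_square.
  rewrite mulr0 sub0r; set l := _%:R.
  by exists (- (c * d * l)); rewrite mulrN -(mulrC delta) !mulrA.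
- apply: alive_sum_bilinear => c d u v.
  rewrite mulrBr mulrBl !pi_mulU alive_sumB !alive_sum_word -!catA.
  have -> : `[< walive C (u ++ [:: s; t;
    s] ++ v) >] = `[< walive C (u ++ [:: s] ++ v) >].
    by apply/asboolP/asboolP; rewrite walive_braid.
  by rewrite subrr; apply: in_delta0.
- by rewrite mulr0 mul0r /alive_sum mmap0; apply: in_delta0.
- by rewrite mulrDr mulrDl alive_sumD; apply: in_deltaD.
- by rewrite mulrA; apply: h.
- by rewrite (mulrA p) -(mulrA (p * x)); apply: h.
Qed.

(** Reduced words are alive, so for a dead [w] the difference from the basis element would have
    [alive_sum] equal to -1, which is not a multiple of [delta]. *)
Lemma monomial_basis_alive w : monomial_basis (tl_word C w) -> walive C w.
Proof.
case=> G p2 /eqP/tl_eqP/alive_sum_ideal/(_ 1 1).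
rewrite mul1r mulr1 alive_sumB !alive_sum_word !mul1r.
have -> : `[< walive C (heap_word G) >] = true.
  apply/asboolP; have [L lL <-] := heap_word_listing G.
  by apply/(listing_alive lL)/reduced_alive/propP2_reduced.
case: asboolP => // _ [l] /esym; rewrite sub0r => e.
by case: (@delta_nonunit l).
Qed.

End TemperleyLieb.

(** * Regularity from deletions, and the equivalences *)

Section Deletion.

Variables (P : choiceType) (C : concurrency P).

(** All ranked heaps are quantified over, because the counting argument deletes from doubled
    heaps. *)
Definition deletion_alive := forall (S : rheap C) (A : {set S}) (a : S),
  reduced A -> a \in A -> alive (A :\ a).

(** A nontrivial heap with P2 has a predecessor by [exists_rprec]; it arises by deleting an extremal
    element, so it has P2 again and induction applies. *)
Lemma deletion_alive_regular : deletion_alive -> regular C.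
Proof.
move=> del E; have [n] := ubnP #|E|; elim: n E => // n IH E /ltnSE-En p2.
have redE : reduced [set: of_heap E] by apply/propP2_reduced.
have [topE|ntop] := eqVneq (tops (of_heap E)) setT.
  by apply: propP1_trivial; apply/htrivialE.
have [a [b prec]] := exists_rprec del redE ntop.
have precE : hprec_plus (a : E) \/ hprec_minus (a : E).
  by case: prec => h; [left; apply/hprec_plusE | right; apply/hprec_minusE];
    exists b.
apply: (@propP1_prec _ _ (hdel (a : E))); last by exists a; split=> //;
  apply: heap_iso_refl.
apply: IH.
  apply: leq_trans En; rewrite card_sig -[X in _ < X]cardsT.
  apply: proper_card; apply/properP; split; first exact: subsetT.
  by exists a; rewrite !inE ?eqxx.
apply/propP2_subheap; rewrite -setTD.
case: prec => [[_ ta _ _ _]|[_ ta _ _ _]]; first exact: reduced_top.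
by apply/reduced_rev; apply: reduced_top ta; apply/reduced_rev.
Qed.

End Deletion.

Theorem theorem1p5p1 (P : choiceType) (C : concurrency P) (k : fieldType) :
  [<-> regular C;
       forall E : heap C, propP2 E -> strongly_acyclic k E;
       forall E : heap C, propP2 E <-> strongly_acyclic k E;
       forall E : heap C, propP2 E ->
         forall a : E, monomial_basis (tl_heap (hdel a));
       forall (u v : seq P) (p : P), propP2 (word_heap C (u ++ p :: v)) ->
         monomial_basis (tl_word C (u ++ v))].
Proof.
have del_heap (E : heap C) (a : E) (L : seq (of_heap E)) :
    listing ([set: of_heap E] :\ a) L ->
    tl_heap (hdel a) = tl_word C [seq rlab x | x <- L].
  move=> lL; apply: tl_word_commutes; apply: heap_word_subheap.
  by rewrite -setTD.
tfae.
- by move=> reg E; apply: regular_strongly_acyclic.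
- by move=> sa E; split; [apply: sa | apply: strongly_acyclic_propP2].
(* Strong acyclicity makes [hdel a] acyclic, hence alive, hence equal to a basis element. *)
- move=> sa E /sa/strongly_acyclicE[_ dac] a.
  rewrite (del_heap _ _ _ (rsort_listing _)); apply: alive_monomial_basis.
  by apply: (@racyclic_alive _ _ k); apply: dac; rewrite inE.
- move=> mono u v p p2.
  have [L lL /map_eq_cat[L1 [[|a L2] [eL e1 // [ea e2]]]]] :=
    word_heap_listing C (u ++ p :: v).
  rewrite eL in lL; have := mono _ p2 a.
  by rewrite (del_heap _ _ _ (listing_drop lL)) map_cat e1 e2.
(* A deletion in a ranked heap becomes the deletion of a letter in a word listing it, and
   [monomial_basis_alive] turns the equality in [TL] into aliveness. *)
move=> mono; apply: deletion_alive_regular => T A a red aA.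
have lL := rsort_listing A; have aL : a \in rsort A by case: lL => _ ->.
case/splitPr: aL lL => L1 L2 lL.
apply/(listing_alive (listing_drop lL)); apply: monomial_basis_alive.
rewrite map_cat; apply: (mono _ _ (rlab a)); apply/propP2_word_heap.
by have := (listing_reduced lL).1 red; rewrite map_cat.
Qed.
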